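(* Let $k>1$ be an odd integer, let $s$ be a positive even integer with $s\le k$, and let $\sigma_k>0$ be any Weyl-admissible exponent for $k$. Then for every $\epsilon>0$ there is a constant $C>0$, depending only on $k,s,\epsilon$ (and the fixed choice of $\sigma_k$), such that for every $N\in\mathbb{N}$ and every set $A\subset\{1,\dots,N\}$ satisfying $(A-A)\cap\mathcal{A}_{k,s}=\emptyset$, one has $$|A|\le C\,N^{1-\frac1k\min\{s\,\sigma_k,\;1/2\}+\epsilon}.$$
   Context: $\mathbb{N}$ denotes the positive integers, $e(x)=e^{2\pi i x}$, and $A-A=\{x-y: x,y\in A\}$. Define $\mathcal{A}_{k,s}=\{a_1^k+\cdots+a_s^k:\ a_1,\dots,a_s\in\mathbb{N}\}$. A real number $\sigma_k>0$ is called Weyl-admissible for $k$ if for every $\delta>0$ there is a constant $C_{k,\delta}$ such that $$\Big|\sum_{1\le m\le X} e(\alpha m^k)\Big|\le C_{k,\delta}\,X^{1+\delta}\left(\frac1q+\frac1X+\frac{q}{X^{k}}\right)^{\sigma_k}$$ for all real $X>0$ and all $\alpha\in\mathbb{R}$, $a\in\mathbb{Z}$, $q\in\mathbb{N}$ with $\gcd(a,q)=1$ and $|\alpha-a/q|\le q^{-2}$. *)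

(* Defs.v *)
From HB Require Import structures.
From mathcomp Require Import all_boot all_order all_algebra finmap.
From mathcomp Require Import all_classical all_reals all_analysis.
From mathcomp Require Import complex.

Set Implicit Arguments.
Unset Strict Implicit.
Unset Printing Implicit Defensive.

Import Order.TTheory GRing.Theory Num.Theory.
Import numFieldNormedType.Exports.

Local Open Scope classical_set_scope.
Local Open Scope ring_scope.
Local Open Scope complex_scope.

(* e(x) = exp(2 pi i x) *)
Definition e_circle (R : realType) (x : R) : R[i] :=
  cos (2 * pi * x) +i* sin (2 * pi * x).

(* For X > 0, [Num.truncn X] is the floor of X, so that the sum ranges over
   the integers 1 <= m <= X. *)
Definition weyl_sum (R : realType) (k : nat) (alpha X : R) : R[i] :=
  \sum_(1 <= m < (Num.truncn X).+1) e_circle (alpha * m%:R ^+ k).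

(* The norm of R[i] takes its values in R[i], whence the cast %:C; the order of
   R[i] compares real parts of numbers with equal imaginary parts. *)
Definition weyl_admissible (R : realType) (k : nat) (sigma : R) : Prop :=
  0 < sigma /\
  forall delta : R, 0 < delta -> exists C : R,
  forall (X alpha : R) (a : int) (q : nat),
    0 < X -> (0 < q)%N -> coprimez a q%:Z ->
    `|alpha - a%:~R / q%:R| <= q%:R ^- 2 ->
    `|weyl_sum k alpha X| <=
      (C * X `^ (1 + delta)
         * (q%:R^-1 + X^-1 + q%:R / X ^+ k) `^ sigma)%:C.

Definition power_sums (k s : nat) : set int :=
  [set n | exists2 a : 'I_s -> nat,
     (forall i, (0 < a i)%N) & n = \sum_(i < s) (a i)%:Z ^+ k].

Definition difference_set (A : set int) : set int :=
  [set x - y | x in A & y in A].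

(* Main.v *)
(* Let P be about N^(1/k) and let f(alpha) be the sum over 1 <= m <= P^(1+delta)
   of exp(-(m/P)^k) e(alpha m^k).  The frequencies of f^s lie in A_(k,s), so the
   mean of |sum_(x in A) e(alpha x)|^2 f(alpha)^s vanishes, and a bound
   Re f^s >= -E for all alpha gives |A| << N E / f(0)^s.

   Near a/q with q large, the Weyl exponent gives |f| << P^(1-sigma+o(1)).  Near
   a/q with q small, put tau = P^(-k) - 2 pi i (alpha - a/q), let g be the mean of
   e(a m^k/q) over a period and compare f with g * sum exp(-tau m^k).  The Weyl
   exponent also bounds the incomplete sums of e(a m^k/q) - g by q^(1-sigma+o(1)),
   and repeated summation by parts (as a Taylor expansion in blocks of length q)
   bounds the error by the same quantity, with no loss in alpha - a/q.  Finally
   sum exp(-tau m^k) is, up to O(1), a nonnegative multiple of exp(-i arg(tau)/k),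
   with |arg(tau)| < pi/2, and g is real because k is odd.  As s is even and s <= k,
   the main term of f^s has nonnegative real part, so E << P^(s - s sigma + o(1)),
   where sigma has been lowered so that s sigma <= 1/2. *)

Require Import Defs.
From HB Require Import structures.
From mathcomp Require Import all_boot all_order all_algebra finmap.
From mathcomp Require Import all_classical all_reals all_analysis.
From mathcomp Require Import complex.
From mathcomp Require Import ring lra zify.

Set Implicit Arguments.
Unset Strict Implicit.
Unset Printing Implicit Defensive.

Import Order.TTheory GRing.Theory Num.Theory.
Import numFieldNormedType.Exports.
Import ComplexField.Normc.

Local Open Scope classical_set_scope.
Local Open Scope ring_scope.

(** * Complex modulus and exponentials *)

(** The damping serves two purposes. It merges with e((alpha - a/q) m^k) into a single exponential
    exp(-tau m^k) with Re tau > 0, and it leaves only O(1) from the terms near or beyond the end of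
    the sum, so no sharp cutoff has to be analysed.

    All losses P^o(1) are measured by one integer D just above P^delta, with P <= D^h. An expansion
    that gains 1/D per order therefore beats any fixed power of P after a number of orders depending
    on h alone. The Dirichlet level P^(k-1) D^(k+1) and the major arc condition q D^(k+1) <= P are
    matched to this: on the major arcs each derivative over a block of length q gains 1/D, and
    elsewhere every term in the base of the Weyl bound is at most D^(k+1)/P.

    With z the main term of f, the difference f^s - z^s contains one factor f - z of size
    q^(1-sigma) and s - 1 factors of size P q^(-sigma). The product P^(s-1) q^(1-s sigma) does not
    decrease with q, and at q = P it meets the minor arc bound P^(s-s sigma). *)

Section ComplexModulus.
Variable R : realType.
Implicit Types (z w : R[i]%C) (x y : R).

Lemma normcE_norm z : `|z| = ((normc z)%:C)%C.
Proof. by rewrite normc_def; case: z. Qed.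

Lemma normc_ge0 z : 0 <= normc z.
Proof. by case: z => a b; exact: sqrtr_ge0. Qed.

Lemma ler_normcD z w : normc (z + w) <= normc z + normc w.
Proof. exact: le_normcD. Qed.

Lemma normc_opp z : normc (- z) = normc z.
Proof. exact: normcN. Qed.

Lemma ler_normcB z w : normc (z - w) <= normc z + normc w.
Proof. by rewrite -(normc_opp w) ler_normcD. Qed.

Lemma ler_normc_sum (I : Type) (r : seq I) (P : pred I) (F : I -> R[i]%C) :
  normc (\sum_(i <- r | P i) F i) <= \sum_(i <- r | P i) normc (F i).
Proof.
elim/big_rec2: _ => [|i y z _ le_zy]; first by rewrite normc0.
by apply: le_trans (ler_normcD _ _) _; rewrite lerD2l.
Qed.

Lemma normcX z n : normc (z ^+ n) = normc z ^+ n.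
Proof. by elim: n => [|n ih]; rewrite ?expr0 ?normc1 // !exprS normcM ih. Qed.

Lemma normc_real x : normc (x%:C)%C = `|x|.
Proof. by rewrite /= expr0n /= addr0 sqrtr_sqr. Qed.

Lemma normc_nat n : normc (n%:R : R[i]%C) = n%:R.
Proof.
have -> : (n%:R : R[i]%C) = ((n%:R : R)%:C)%C by rewrite rmorph_nat.
by rewrite normc_real ger0_norm.
Qed.

Lemma normr_Re_le z : `|complex.Re z| <= normc z.
Proof.
case: z => a b /=; rewrite -sqrtr_sqr ler_wsqrtr //.
by rewrite lerDl sqr_ge0.
Qed.

Lemma Re_le_normc z : complex.Re z <= normc z.
Proof. exact: le_trans (ler_norm _) (normr_Re_le z). Qed.

Lemma Re_ge_opp_normc z : - normc z <= complex.Re z.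
Proof.
by have := normr_Re_le z; rewrite ler_norml => /andP[].
Qed.

Lemma normc_conj z : normc (z^*)%C = normc z.
Proof. by case: z => a b /=; rewrite sqrrN. Qed.

Lemma mulc_conj z : z * (z^*)%C = ((normc z ^+ 2)%:C)%C.
Proof.
case: z => a b; rewrite /= sqr_sqrtr ?addr_ge0 ?sqr_ge0 //.
by apply/eqP; rewrite eq_complex /= !expr2; apply/andP; split; apply/eqP; ring.
Qed.

Lemma ReD z w : complex.Re (z + w) = complex.Re z + complex.Re w.
Proof. by case: z w => [a b] [c d]. Qed.

Lemma ImD z w : complex.Im (z + w) = complex.Im z + complex.Im w.
Proof. by case: z w => [a b] [c d]. Qed.

Lemma Re_sum (I : Type) (r : seq I) (P : pred I) (F : I -> R[i]%C) :
  complex.Re (\sum_(i <- r | P i) F i) = \sum_(i <- r | P i) complex.Re (F i).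
Proof. exact: (big_morph _ ReD). Qed.

Lemma Re_realM x z : complex.Re ((x%:C)%C * z) = x * complex.Re z.
Proof. by case: z => a b; rewrite /= mul0r subr0. Qed.

(** In the factorisation of a difference of powers, each of the n + 1 products has n factors bounded
    by [B]. This carries an approximation of an exponential sum over to its [s]-th power. *)
Lemma normc_expB_le z w (n : nat) (B : R) :
  normc z <= B -> normc w <= B ->
  normc (z ^+ n.+1 - w ^+ n.+1) <= n.+1%:R * normc (z - w) * B ^+ n.
Proof.
move=> zB wB; rewrite subrXX normcM mulrAC mulrC ler_wpM2r ?normc_ge0 //.
apply: le_trans (ler_normc_sum _ _ _) _.
have -> : n.+1%:R * B ^+ n = \sum_(i < n.+1) B ^+ n.
  by rewrite sumr_const card_ord mulr_natl.
apply: ler_sum => i _; rewrite normcM !normcX.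
have in_ : (i <= n)%N by rewrite -ltnS.
rewrite -[X in _ <= B ^+ X](subnK in_) exprD.
by rewrite ler_pM ?exprn_ge0 ?normc_ge0 // lerXn2r ?nnegrE ?normc_ge0 //;
   exact: le_trans (normc_ge0 _) zB.
Qed.

Definition cexp (z : R[i]%C) : R[i]%C :=
  (Complex (expR (complex.Re z) * cos (complex.Im z))
           (expR (complex.Re z) * sin (complex.Im z))).

Lemma cexp0 : cexp 0 = 1.
Proof. by rewrite /cexp /= expR0 cos0 sin0 mulr1 mulr0. Qed.

Lemma cexpD z w : cexp (z + w) = cexp z * cexp w.
Proof.
case: z w => [a b] [c d]; apply/eqP; rewrite eq_complex /= expRD cosD sinD.
by apply/andP; split; apply/eqP; ring.
Qed.

Lemma cexpMn z n : cexp (z *+ n) = cexp z ^+ n.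
Proof.
elim: n => [|n ih]; first by rewrite cexp0.
by rewrite mulrS cexpD ih exprS.
Qed.

Lemma normc_cexp z : normc (cexp z) = expR (complex.Re z).
Proof.
by rewrite /= !exprMn -mulrDr cos2Dsin2 mulr1 sqrtr_sqr ger0_norm ?expR_ge0.
Qed.

Lemma cexp_real x : cexp (x%:C)%C = ((expR x)%:C)%C.
Proof. by rewrite /cexp /= cos0 sin0 mulr1 mulr0. Qed.

Lemma e_circle_cexp x : e_circle x = cexp (Complex 0 (2 * pi * x)).
Proof. by rewrite /cexp /= expR0 !mul1r. Qed.

Lemma e_circleD x y : e_circle (x + y) = e_circle x * e_circle y.
Proof.
rewrite !e_circle_cexp -cexpD; congr cexp.
by apply/eqP; rewrite eq_complex /= addr0 mulrDr !eqxx.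
Qed.

Lemma e_circle0 : e_circle (0 : R) = 1.
Proof. by rewrite /e_circle mulr0 cos0 sin0. Qed.

Lemma normc_e_circle x : normc (e_circle x) = 1.
Proof. by rewrite e_circle_cexp normc_cexp expR0. Qed.

Lemma e_circleN x : e_circle (- x) = ((e_circle x)^*)%C.
Proof. by rewrite /e_circle mulrN cosN sinN. Qed.

Lemma e_circle_sum (I : Type) (r : seq I) (P : pred I) (F : I -> R) :
  e_circle (\sum_(i <- r | P i) F i) = \prod_(i <- r | P i) e_circle (F i).
Proof. exact: (big_morph _ e_circleD e_circle0). Qed.

Lemma e_circle_nat n : e_circle (n%:R : R) = 1.
Proof.
elim: n => [|n ih]; first exact: e_circle0.
rewrite -addn1 natrD e_circleD ih mul1r /e_circle mulr1 mulr_natl.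
by rewrite cos2pi sin2pi.
Qed.

Lemma e_circle_int (m : int) : e_circle (m%:~R : R) = 1.
Proof.
case: m => n; first exact: e_circle_nat.
by rewrite NegzE mulrNz e_circleN e_circle_nat conjc1.
Qed.

Lemma e_circleMn x n : e_circle (x *+ n) = e_circle x ^+ n.
Proof.
elim: n => [|n ih]; first by rewrite e_circle0.
by rewrite mulrS e_circleD ih exprS.
Qed.

Lemma e_circle_eq1 x : 0 < x < 1 -> e_circle x <> 1.
Proof.
move=> /andP[x0 x1] [] /= c1 _.
have := cos_mulr2n (pi * x).
have -> : (pi * x) *+ 2 = 2 * pi * x by ring.
rewrite c1 => h.
have s0 : 0 < sin (pi * x).
  by apply: sin_gt0_pi; rewrite mulr_gt0 ?pi_gt0 //= gtr_pMr ?pi_gt0.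
have := cos2Dsin2 (pi * x).
have : 0 < sin (pi * x) ^+ 2 by rewrite exprn_gt0.
have : cos (pi * x) ^+ 2 = 1 by lra.
lra.
Qed.

End ComplexModulus.

(** * Derivatives of complex-valued functions *)

Section ComplexDerivative.
Variable R : realType.
Implicit Types (f g : R -> R[i]%C) (t x y : R) (z w : R[i]%C).

Definition is_cderive f t z : Prop :=
  is_derive t 1 (fun x => complex.Re (f x)) (complex.Re z) /\
  is_derive t 1 (fun x => complex.Im (f x)) (complex.Im z).

Lemma is_cderive_eq f t z w : is_cderive f t z -> z = w -> is_cderive f t w.
Proof. by move=> ? <-. Qed.

Lemma is_cderive_cst z t : is_cderive (fun=> z) t 0.
Proof. by split; exact: is_derive_cst. Qed.

Lemma is_cderiveD f g t z w : is_cderive f t z -> is_cderive g t w ->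
  is_cderive (fun x => f x + g x) t (z + w).
Proof.
move=> [f1 f2] [g1 g2]; split.
- have -> : (fun x => complex.Re (f x + g x)) =
    (fun x => complex.Re (f x)) + (fun x => complex.Re (g x)).
    by apply/funext => x; rewrite ReD.
  by rewrite ReD; exact: is_deriveD.
- have -> : (fun x => complex.Im (f x + g x)) =
    (fun x => complex.Im (f x)) + (fun x => complex.Im (g x)).
    by apply/funext => x; rewrite ImD.
  by rewrite ImD; exact: is_deriveD.
Qed.

Lemma is_cderiveM f g t z w : is_cderive f t z -> is_cderive g t w ->
  is_cderive (fun x => f x * g x) t (z * g t + f t * w).
Proof.
move=> [f1 f2] [g1 g2]; split.
- have -> : (fun x => complex.Re (f x * g x)) =
    ((fun x => complex.Re (f x)) * (fun x => complex.Re (g x)))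
    - ((fun x => complex.Im (f x)) * (fun x => complex.Im (g x))).
    by apply/funext => x; rewrite !fctE; case: (f x) (g x) => [a b] [c d].
  apply: is_derive_eq (is_deriveB (is_deriveM f1 g1) (is_deriveM f2 g2)) _.
  rewrite /GRing.scale /=.
  case: z w {f1 f2 g1 g2} (f t) (g t) => [a b] [c d] [a' b'] [c' d'] /=; ring.
- have -> : (fun x => complex.Im (f x * g x)) =
    ((fun x => complex.Re (f x)) * (fun x => complex.Im (g x)))
    + ((fun x => complex.Im (f x)) * (fun x => complex.Re (g x))).
    by apply/funext => x; rewrite !fctE; case: (f x) (g x) => [a b] [c d].
  apply: is_derive_eq (is_deriveD (is_deriveM f1 g2) (is_deriveM f2 g1)) _.
  rewrite /GRing.scale /=.
  case: z w {f1 f2 g1 g2} (f t) (g t) => [a b] [c d] [a' b'] [c' d'] /=; ring.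
Qed.

Lemma is_cderive_scale z f t w :
  is_cderive f t w -> is_cderive (fun x => z * f x) t (z * w).
Proof.
move=> /(is_cderiveM (is_cderive_cst z t)) h.
by apply: is_cderive_eq h _; rewrite mul0r add0r.
Qed.

Lemma is_cderive_sum (I : Type) (r : seq I) (F : I -> R -> R[i]%C)
    (G : I -> R[i]%C) t : (forall i, is_cderive (F i) t (G i)) ->
  is_cderive (fun x => \sum_(i <- r) F i x) t (\sum_(i <- r) G i).
Proof.
move=> h; elim: r => [|i r ih].
  rewrite big_nil (_ : (fun x => _) = (fun=> 0)).
    exact: is_cderive_cst.
  by apply/funext => x; rewrite big_nil.
rewrite big_cons (_ : (fun x => _) =
  (fun x => F i x + \sum_(i <- r) F i x)); first exact: is_cderiveD.
by apply/funext => x; rewrite big_cons.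
Qed.

Lemma is_cderive_real (f : R -> R) t df :
  is_derive t 1 f df -> is_cderive (fun x => (f x)%:C%C) t df%:C%C.
Proof. by move=> h; split => //=; exact: is_derive_cst. Qed.

Lemma is_cderive_comp f (g : R -> R) t z dg :
  is_cderive f (g t) z -> is_derive t 1 g dg ->
  is_cderive (fun x => f (g x)) t (dg%:C%C * z).
Proof.
move=> [f1 f2] g'; split.
- apply: is_derive_eq (is_derive1_comp f1 g') _.
  by rewrite Re_realM mulrC.
- apply: is_derive_eq (is_derive1_comp f2 g') _.
  by case: z {f1 f2} => a b /=; rewrite mul0r addr0 mulrC.
Qed.

Lemma is_cderive_cexp f t z :
  is_cderive f t z -> is_cderive (fun x => cexp (f x)) t (z * cexp (f t)).
Proof.
move=> [f1 f2]; have e1 := is_derive1_comp (is_derive_expR _) f1.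
split.
- have := is_deriveM e1 (is_derive1_comp (is_derive_cos _) f2).
  move=> h; apply: is_derive_eq h _.
  by rewrite /GRing.scale /=; case: z {f1 f2 e1} => a b /=; ring.
- have := is_deriveM e1 (is_derive1_comp (is_derive_sin _) f2).
  move=> h; apply: is_derive_eq h _.
  by rewrite /GRing.scale /=; case: z {f1 f2 e1} => a b /=; ring.
Qed.

Lemma is_cderive_horner (p : {poly R[i]%C}) t :
  is_cderive (fun x => p.[x%:C%C]) t (p^`()).[t%:C%C].
Proof.
elim/poly_ind: p => [|p c ih].
  rewrite deriv0 horner0 (_ : (fun x => _) = (fun=> 0)).
    exact: is_cderive_cst.
  by apply/funext => x; rewrite horner0.
have -> : (fun x => (p * 'X + c%:P).[x%:C%C]) =
          (fun x => p.[x%:C%C] * x%:C%C + c).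
  by apply/funext => x; rewrite !hornerE.
apply: is_cderive_eq.
  apply: is_cderiveD (is_cderive_cst c t).
  exact: is_cderiveM ih (is_cderive_real (is_derive_id t 1)).
by rewrite derivD derivM derivX derivC !hornerE.
Qed.

(** The mean value theorem fails for complex values, so its real form is applied to the projection
    Re(conj(w) f), where [w] is the total increment. The projection increases by |w|^2, and one
    factor |w| cancels. *)
Lemma cmean_value f (df : R -> R[i]%C) (a b B : R) : a <= b ->
  (forall x, a <= x <= b -> is_cderive f x (df x)) ->
  (forall x, a <= x <= b -> normc (df x) <= B) ->
  normc (f b - f a) <= B * (b - a).
Proof.
move=> ab fdf dfB; set w := f b - f a.
pose g x := complex.Re w * complex.Re (f x) + complex.Im w * complex.Im (f x).
pose dg x := complex.Re w * complex.Re (df x)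
  + complex.Im w * complex.Im (df x).
have gdg x : a <= x <= b -> is_derive x 1 g (dg x).
  move=> /fdf[f1 f2]; exact: is_deriveD (is_deriveZ _ f1) (is_deriveZ _ f2).
have [||c] := @MVT_segment R g dg a b ab.
- by move=> x; rewrite in_itv /= => /andP[/ltW ax /ltW xb]; apply: gdg; rewrite ax.
- apply: derivable_within_continuous => x; rewrite in_itv /= => xab.
  by have [] := gdg _ xab.
rewrite in_itv /= => cab.
have -> : g b - g a = normc w ^+ 2.
  rewrite /g; have := erefl w; rewrite {2}/w.
  case: (f b) (f a) w {g dg gdg} => [b1 b2] [a1 a2] [w1 w2] /= [-> ->].
  rewrite sqr_sqrtr ?addr_ge0 ?sqr_ge0 //; ring.
move=> wE; have [w0|w0] := eqVneq (normc w) 0.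
  rewrite w0 mulr_ge0 ?subr_ge0 //.
  exact: le_trans (normc_ge0 _) (dfB _ cab).
have wp : 0 < normc w by rewrite lt_def w0 normc_ge0.
rewrite -(ler_pM2l wp) -expr2 wE mulrA ler_wpM2r ?subr_ge0 //.
have -> : dg c = complex.Re ((w^*)%C * df c).
  by rewrite /dg; case: (w) (df c) => [? ?] [? ?] /=; rewrite mulNr opprK.
apply: le_trans (Re_le_normc _) _; rewrite normcM normc_conj.
by rewrite ler_wpM2l ?normc_ge0 // dfB.
Qed.

End ComplexDerivative.

(** * Sums of smooth functions against periodic coefficients *)

Section EulerMaclaurin.
Variable R : realType.

Lemma is_derive_monomial_fact (j : nat) (x : R) :
  is_derive x 1 (fun y : R => y ^+ j.+1 / j.+1`!%:R) (x ^+ j / j`!%:R).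
Proof.
have -> : (fun y : R => y ^+ j.+1 / j.+1`!%:R) =
    (j.+1`!%:R)^-1 \*: ((@id R) ^+ j.+1).
  by apply/funext => y; rewrite !fctE /GRing.scale /= mulrC.
apply: is_derive_eq (is_deriveZ _ (is_deriveX j.+1 (is_derive_id x (1 : R)))) _.
rewrite /GRing.scale /= factS natrM; field.
by rewrite pnatr_eq0 -lt0n fact_gt0 nat1r pnatr_eq0.
Qed.

(** [F] lists a function with its successive derivatives. The derivative in r of a remainder of
    order J + 1 is a remainder of order J for the next function of the list, so the mean value
    inequality gains one factor r per order. The factor 1/J! is given up. *)
Lemma ctaylor (F : nat -> R -> R[i]%C)
    (F' : forall j (t : R), is_cderive (F j) t (F j.+1 t)) (J i : nat) (a r B : R) :
  0 <= r -> (forall x, a <= x <= a + r -> normc (F (i + J)%N x) <= B) ->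
  normc (F i (a + r) - \sum_(j < J) (r ^+ j / j`!%:R)%:C%C * F (i + j)%N a)
    <= B * r ^+ J.
Proof.
elim: J i r => [|J ih] i r r0 FB.
  by rewrite big_ord0 subr0 mulr1 -[i in F i]addn0 FB // lexx lerDl r0.
pose g (x : R) := F i (a + x)
  + (-1) * \sum_(j < J.+1) (x ^+ j / j`!%:R)%:C%C * F (i + j)%N a.
pose dg (x : R) := F i.+1 (a + x)
  + (-1) * \sum_(j < J) (x ^+ j / j`!%:R)%:C%C * F (i.+1 + j)%N a.
have g'  x : is_cderive g x (dg x).
  apply: is_cderiveD.
    apply: is_cderive_eq (@is_cderive_comp _ (F i) (fun x => a + x) x _ 1
      (F' _ _) _) _; last by rewrite mul1r.
    have := is_deriveD (is_derive_cst a x 1) (is_derive_id x (1 : R)).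
    by rewrite add0r.
  apply: is_cderive_scale.
  rewrite (_ : (fun x => _) = fun x => F i a
      + \sum_(j < J) (x ^+ j.+1 / j.+1`!%:R)%:C%C * F (i.+1 + j)%N a); last first.
    apply/funext => y; rewrite big_ord_recl /= expr0 fact0 divr1 mul1r addn0.
    by congr (_ + _); apply: eq_bigr => j _; rewrite /bump /= add1n addSnnS.
  apply: is_cderive_eq.
    apply: is_cderiveD (is_cderive_cst _ x) _.
    apply: is_cderive_sum => j.
    apply: is_cderiveM (is_cderive_real (is_derive_monomial_fact j x)) _.
    exact: is_cderive_cst.
  by rewrite add0r; apply: eq_bigr => j _; rewrite mulr0 addr0.
have g0 : g 0 = 0.
  rewrite /g big_ord_recl /= big1 => [|j _]; last first.
    by rewrite /bump /= add1n exprS !mul0r.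
  by rewrite expr0 fact0 divr1 mul1r addn0 !addr0 mulN1r subrr.
have := @cmean_value R g dg 0 r (B * r ^+ J) r0 (fun x _ => g' x).
rewrite g0 !subr0 exprSr mulrA {1}/g mulN1r; apply => x /andP[x0 xr].
rewrite /dg mulN1r.
apply: le_trans (ih i.+1 x x0 _) _.
  move=> y /andP[ay yx]; rewrite addSnnS FB // ay /=.
  by apply: le_trans yx _; rewrite lerD2l.
have B0 : 0 <= B by apply: le_trans (normc_ge0 _) (FB a _); rewrite lexx lerDl.
by rewrite ler_wpM2l // lerXn2r ?nnegrE.
Qed.

(** This solves the recursion in [sum_derivative_le]: a sum bounded by all the higher ones plus a
    constant costs a doubling per order. *)
Lemma sum_pow2_rev (d : nat) :
  2 + \sum_(l < d) 2 ^+ (d - l).+1 <= 2 ^+ d.+2 :> R.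
Proof.
elim: d => [|d ih]; first by rewrite big_ord0 addr0 expr2; lra.
rewrite big_ord_recl /= subn0.
rewrite (eq_bigr (fun l : 'I_d => 2 ^+ (d - l).+1)) => [|l _]; last first.
  by rewrite /bump /= add1n subSS.
by rewrite addrCA [X in _ <= X]exprS mulr2n mulrDl mul1r lerD2l.
Qed.

(* Taylor at each integer turns the telescoping sum of [F j0] into
   [S (j0+1) + S (j0+2)/2! + ...], so that the sums [S j] of the derivatives
   are bounded successively from the highest order down. *)
Lemma sum_derivative_le (F : nat -> R -> R[i]%C)
    (F' : forall j (t : R), is_cderive (F j) t (F j.+1 t)) (J Y : nat) (b B : R) :
  0 <= b ->
  (forall j, (j < J)%N -> normc (F j 0) <= b /\ normc (F j Y%:R) <= b) ->
  (forall t : R, 0 <= t <= Y%:R -> normc (F J t) <= B) ->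
  forall j, (0 < j <= J)%N ->
  normc (\sum_(n < Y) F j n%:R) <= 2 ^+ J.+1 * (b + Y%:R * B).
Proof.
move=> b0 Fb FB; pose V := b + Y%:R * B.
have B0 : 0 <= B.
  by apply: le_trans (normc_ge0 _) (FB 0 _); rewrite lexx ler0n.
have V0 : 0 <= V by rewrite addr_ge0 // mulr_ge0.
(* [d] counts the orders below the top one; the induction is strong because each order uses all the
   higher ones. *)
suff key : forall d j, (j.+1 + d = J)%N ->
    normc (\sum_(n < Y) F j.+1 n%:R) <= 2 ^+ d.+1 * V.
  move=> [//|j] /= jJ; apply: le_trans (key (J - j.+1)%N j _) _.
    by rewrite subnKC.
  by rewrite ler_wpM2r // ler_weXn2l ?ler1n // ltnS leq_subr.
elim/ltn_ind => -[|d] ih j jd.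
  rewrite addn0 in jd; apply: le_trans (ler_normc_sum _ _ _) _.
  rewrite jd; apply: (@le_trans _ _ (Y%:R * B)).
    rewrite mulr_natl -[X in _ *+ X]card_ord -sumr_const.
    by apply: ler_sum => n _; apply: FB; rewrite ler0n ler_nat ltnW /=.
  by move: (mulr_ge0 (ler0n R Y) B0); rewrite expr1 /V => ?; lra.
pose S m := \sum_(n < Y) F m n%:R.
pose E n := F j (n%:R + 1)
  - \sum_(l < d.+2) (1 ^+ l / l`!%:R)%:C%C * F (j + l)%N n%:R.
have EB n : (n < Y)%N -> normc (E n) <= B.
  move=> nY; have := @ctaylor F F' d.+2 j n%:R 1 B ler01.
  rewrite [1 ^+ d.+2]expr1n mulr1; apply => x /andP[nx xn].
  rewrite (_ : (j + d.+2 = J)%N); last by rewrite -jd addSnnS.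
  apply: FB; rewrite (le_trans _ nx) ?ler0n //=.
  by apply: le_trans xn _; rewrite natr1 ler_nat.
have eqE : S j.+1 = F j Y%:R - F j 0
    - \sum_(l < d) (1 / l.+2`!%:R)%:C%C * S (j + l.+2)%N - \sum_(n < Y) E n.
  have -> : F j Y%:R - F j 0 = \sum_(n < Y) (F j (n%:R + 1) - F j n%:R).
    rewrite -(@big_mkord _ _ _ _ xpredT
      (fun n => F j (n%:R + 1) - F j n%:R)).
    rewrite (@telescope_sumr_eq _ 0 Y (fun n => F j n%:R)) //.
    by move=> n _; rewrite -natr1.
  have -> : \sum_(l < d) (1 / l.+2`!%:R)%:C%C * S (j + l.+2)%N =
      \sum_(n < Y) \sum_(l < d) (1 / l.+2`!%:R)%:C%C * F (j + l.+2)%N n%:R.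
    by rewrite exchange_big; apply: eq_bigr => l _; rewrite mulr_sumr.
  rewrite -!sumrB; apply: eq_bigr => n _; rewrite /E !big_ord_recl /=.
  rewrite !expr0 fact0 /bump /= !add1n expr1 divr1 !mul1r addn0 addn1.
  under [X in _ - (_ - (_ + (_ + X)))]eq_bigr => l _.
    rewrite !add1n expr1n; over.
  ring.
have -> : \sum_(n < Y) F j.+1 n%:R = S j.+1 by [].
rewrite eqE; apply: le_trans (ler_normcB _ _) _.
have h1 : normc (\sum_(n < Y) E n) <= Y%:R * B.
  apply: le_trans (ler_normc_sum _ _ _) _.
  rewrite mulr_natl -[X in _ *+ X]card_ord -sumr_const.
  by apply: ler_sum => n _; exact: EB.
have h2 : normc (\sum_(l < d) (1 / l.+2`!%:R)%:C%C * S (j + l.+2)%N)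
    <= \sum_(l < d) 2 ^+ (d - l).+1 * V.
  apply: le_trans (ler_normc_sum _ _ _) _; apply: ler_sum => l _.
  rewrite normcM normc_real -[X in _ <= X]mul1r ler_pM ?normc_ge0 //.
    rewrite ger0_norm ?divr_ge0 // mul1r invf_le1 ?ltr0n ?fact_gt0 //.
    by rewrite ler1n fact_gt0.
  rewrite addnS; apply: ih; first by rewrite ltnS leq_subr.
  rewrite -jd; have := ltn_ord l; lia.
rewrite -mulr_suml in h2.
have [h3 _] : normc (F j 0) <= b /\ normc (F j Y%:R) <= b by apply: Fb; lia.
have [_ h4] : normc (F j 0) <= b /\ normc (F j Y%:R) <= b by apply: Fb; lia.
have := ler_normcB (F j Y%:R) (F j 0).
have := ler_normcB (F j Y%:R - F j 0)
  (\sum_(l < d) (1 / l.+2`!%:R)%:C%C * S (j + l.+2)%N).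
have := ler_wpM2r V0 (sum_pow2_rev d).
move: (mulr_ge0 (ler0n R Y) B0).
by rewrite mulrDl => i0 i1 i2 i3; move: i1; rewrite {1}/V => i1; lra.
Qed.

Lemma sum_by_parts (T : comPzRingType) (c u : nat -> T) (n : nat) :
  \sum_(m < n.+1) c m * u m = (\sum_(m < n.+1) c m) * u n
    + \sum_(m < n) (\sum_(i < m.+1) c i) * (u m - u m.+1).
Proof.
elim: n => [|n ih]; first by rewrite !big_ord_recl !big_ord0 !addr0.
rewrite big_ord_recr /= ih [X in _ = _ + X]big_ord_recr /=.
have -> : \sum_(i < n.+2) c i = \sum_(i < n.+1) c i + c n.+1.
  by rewrite big_ord_recr.
ring.
Qed.

(** Summation by parts costs [K] for the last weight and [K] for the total variation of the weights,
    each at most 1. *)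
Lemma sum_mul_monotone_le (c : nat -> R[i]%C) (u : nat -> R) (n : nat) (K : R) :
  (forall x, (x <= n)%N -> normc (\sum_(i < x) c i) <= K) ->
  (forall m, 0 <= u m <= u m.+1) -> u n <= 1 ->
  normc (\sum_(m < n) c m * (u m)%:C%C) <= 2 * K.
Proof.
move=> cK um un; have K0 : 0 <= K.
  by apply: le_trans (cK 0%N _); rewrite ?normc_ge0.
case: n => [|n] in cK un *; first by rewrite big_ord0 normc0 mulr_ge0.
have u0 m : 0 <= u m by case/andP: (um m).
have uS m : u m <= u m.+1 by case/andP: (um m).
have un1 : u n <= 1 by apply: le_trans un.
rewrite (@sum_by_parts _ c (fun m => (u m)%:C%C)).
apply: le_trans (ler_normcD _ _) _.
have h1 : normc ((\sum_(m < n.+1) c m) * (u n)%:C%C) <= K * u n.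
  rewrite normcM normc_real ger0_norm // ler_wpM2r //.
  by apply: cK.
have h2 : normc (\sum_(m < n)
    (\sum_(i < m.+1) c i) * ((u m)%:C%C - (u m.+1)%:C%C)) <= K * (u n - u 0%N).
  apply: le_trans (ler_normc_sum _ _ _) _.
  rewrite -(telescope_sumr u (leq0n n)) big_mkord mulr_sumr.
  apply: ler_sum => m _; rewrite normcM -rmorphB normc_real distrC.
  rewrite ger0_norm ?subr_ge0 // ler_wpM2r ?subr_ge0 //.
  by apply: cK; have := ltn_ord m; lia.
have i1 := mulr_ge0 K0 (u0 0%N).
have i2 := ler_wpM2l K0 un1.
by lra.
Qed.

Lemma sum_blocks (T : nmodType) (f : nat -> T) (q Y : nat) :
  \sum_(m < q * Y) f m = \sum_(n < Y) \sum_(r < q) f (q * n + r)%N.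
Proof.
elim: Y => [|Y ih]; first by rewrite muln0 !big_ord0.
by rewrite big_ord_recr /= -ih mulnSr big_split_ord.
Qed.

(* Expanding [F 0] in a Taylor series at the left end of each block of length
   [q], the zeroth order term vanishes by the mean zero condition and the others
   are sums of derivatives along a progression. *)
Lemma sum_periodic_smooth_le (c : nat -> R[i]%C) (q : nat) (K : R)
    (F : nat -> R -> R[i]%C) (J Y : nat) (b B : R) :
  (0 < q)%N -> (forall m, c (q + m)%N = c m) -> \sum_(r < q) c r = 0 ->
  (forall x, (x <= q)%N -> normc (\sum_(i < x) c i) <= K) ->
  (forall m, normc (c m) <= 2) ->
  (forall j (t : R), is_cderive (F j) t (F j.+1 t)) -> 0 <= b ->
  (forall j, (j < J)%N -> q%:R ^+ j * normc (F j 0) <= b /\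
                          q%:R ^+ j * normc (F j (q * Y)%:R) <= b) ->
  (forall t : R, 0 <= t <= (q * Y)%:R -> q%:R ^+ J * normc (F J t) <= B) ->
  normc (\sum_(m < q * Y) c m * F 0%N m%:R) <=
    J%:R * 2 ^+ J.+2 * K * (b + Y%:R * B) + (q * Y)%:R * (2 * B).
Proof.
move=> q0 cper c0 cK c2 F' b0 Fb FB.
have qR : 0 < q%:R :> R by rewrite ltr0n.
have K0 : 0 <= K by apply: le_trans (cK 0%N _); rewrite ?normc_ge0.
have B0 : 0 <= B.
  apply: le_trans (FB 0 _); first by rewrite mulr_ge0 ?normc_ge0 ?exprn_ge0.
  by rewrite lexx ler0n.
pose V := b + Y%:R * B; have V0 : 0 <= V by rewrite addr_ge0 // mulr_ge0.
(* Rescaling by [q] sends the left ends of the blocks to consecutive integers, as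
   [sum_derivative_le] requires. *)
pose H j (t : R) := (q%:R ^+ j)%:C%C * F j (q%:R * t).
have H' j t : is_cderive (H j) t (H j.+1 t).
  have h := is_cderive_comp (F' j (q%:R * t))
    (is_deriveZ q%:R (is_derive_id t (1 : R))).
  apply: is_cderive_eq (is_cderive_scale _ h) _.
  by rewrite /H /GRing.scale /= mulr1 exprSr rmorphM mulrA.
have normH j t : normc (H j t) = q%:R ^+ j * normc (F j (q%:R * t)).
  by rewrite /H normcM normc_real ger0_norm ?exprn_ge0.
pose T j := \sum_(n < Y) H j n%:R.
have TV j : (0 < j <= J)%N -> normc (T j) <= 2 ^+ J.+1 * V.
  apply: (sum_derivative_le H') => // [i iJ|t /andP[t0 tY]].
    by rewrite !normH mulr0 -natrM; exact: Fb.
  by rewrite normH; apply: FB; rewrite mulr_ge0 //= natrM ler_pM2l.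
have cq n r : c (q * n + r)%N = c r.
  by elim: n => [|n ih]; rewrite ?muln0 // mulnS -addnA cper ih.
pose E n r := F 0%N ((q * n)%:R + r%:R)
  - \sum_(j < J) (r%:R ^+ j / j`!%:R)%:C%C * F (0 + j)%N (q * n)%:R.
have EB n r : (n < Y)%N -> (r < q)%N -> normc (E n r) <= B.
  move=> nY rq.
  apply: (le_trans (@ctaylor F F' J 0 (q * n)%:R r%:R (B / q%:R ^+ J) _ _)).
  - exact: ler0n.
  - move=> x /andP[x1 x2]; rewrite ler_pdivlMr ?exprn_gt0 // mulrC add0n.
    apply: FB; rewrite (le_trans _ x1) ?ler0n //=.
    apply: le_trans x2 _; rewrite -natrD ler_nat.
    have : (q * n.+1 <= q * Y)%N by rewrite leq_mul2l nY orbT.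
    by rewrite mulnS; lia.
  - rewrite -mulrA -[X in _ <= X]mulr1 ler_wpM2l // mulrC -expr_div_n.
    rewrite exprn_ile1 ?divr_ge0 // ler_pdivrMr // mul1r ler_nat ltnW //.
(* Moments of [c] over one block. Dividing by q^j makes the weights increase up to 1, so the bound 2
   K is uniform in j; the factor q^j goes into [H]. *)
pose w j := \sum_(r < q) c r * ((r%:R / q%:R) ^+ j)%:C%C.
have wK j : normc (w j) <= 2 * K.
  apply: (@sum_mul_monotone_le c (fun r => (r%:R / q%:R) ^+ j)) => // [m|].
    rewrite exprn_ge0 ?divr_ge0 //= lerXn2r ?nnegrE ?divr_ge0 //.
    by rewrite ler_pM2r ?invr_gt0 // ler_nat.
  by rewrite divff ?gt_eqF // expr1n.
have w0 : w 0%N = 0.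
  by rewrite /w -[RHS]c0; apply: eq_bigr => r _; rewrite expr0 mulr1.
have -> : \sum_(m < q * Y) c m * F 0%N m%:R =
    \sum_(j < J) (j`!%:R^-1)%:C%C * (w j * T j)
    + \sum_(n < Y) \sum_(r < q) c r * E n r.
  rewrite (sum_blocks (fun m => c m * F 0%N m%:R)).
  have -> : \sum_(j < J) (j`!%:R^-1)%:C%C * (w j * T j) =
    \sum_(n < Y) \sum_(r < q) c r *
      \sum_(j < J) (r%:R ^+ j / j`!%:R)%:C%C * F (0 + j)%N (q * n)%:R.
    under [RHS]eq_bigr => n _ do under eq_bigr => r _ do rewrite mulr_sumr.
    under [RHS]eq_bigr => n _ do rewrite exchange_big.
    rewrite [RHS]exchange_big; apply: eq_bigr => j _.
    rewrite [w j * T j]mulr_sumr mulr_sumr; apply: eq_bigr => n _.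
    rewrite mulr_suml mulr_sumr; apply: eq_bigr => r _.
    rewrite /H add0n natrM.
    have -> : (r%:R ^+ j / j`!%:R)%:C%C = (j`!%:R^-1)%:C%C *
        ((r%:R / q%:R) ^+ j)%:C%C * (q%:R ^+ j)%:C%C :> R[i]%C.
      rewrite -!rmorphM; congr (_%:C%C); rewrite expr_div_n; field.
      by rewrite expf_neq0 ?gt_eqF //= pnatr_eq0 -lt0n fact_gt0.
    ring.
  rewrite -big_split; apply: eq_bigr => n _.
  rewrite -big_split; apply: eq_bigr => r _.
  by rewrite /= cq -mulrDr /E natrD [X in _ = _ * X]addrC subrK.
have -> : J%:R * 2 ^+ J.+2 * K * (b + Y%:R * B) =
    J%:R * (2 * K * (2 ^+ J.+1 * V)) by rewrite /V exprS; ring.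
have := TV; move: (2 ^+ J.+1 * V) => W TW.
apply: le_trans (ler_normcD _ _) _; apply: lerD.
- apply: le_trans (ler_normc_sum _ _ _) _.
  rewrite mulr_natl -[X in _ *+ X]card_ord -sumr_const.
  apply: ler_sum => j _; rewrite normcM normc_real normcM.
  have f0 : 0 < j`!%:R :> R by rewrite ltr0n fact_gt0.
  rewrite ger0_norm ?invr_ge0 ?(ltW f0) //.
  have W0 : 0 <= W.
    apply: le_trans (normc_ge0 _) (TW J _).
    by rewrite leqnn andbT; have := ltn_ord j; lia.
  have [->|j0] := eqVneq (j : nat) 0%N.
    by rewrite w0 normc0 mul0r mulr0 !mulr_ge0.
  rewrite -[X in _ <= X]mul1r ler_pM ?invr_ge0 ?mulr_ge0 ?normc_ge0 ?(ltW f0) //.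
    by rewrite invf_le1 // ler1n fact_gt0.
  by rewrite ler_pM ?normc_ge0 // TW // lt0n j0 ltnW.
- apply: le_trans (ler_normc_sum _ _ _) _.
  rewrite natrM [q%:R * _]mulrC -!mulrA mulr_natl.
  rewrite -[X in _ *+ X]card_ord -sumr_const.
  apply: ler_sum => n _; apply: le_trans (ler_normc_sum _ _ _) _.
  rewrite mulr_natl -[X in _ *+ X]card_ord -sumr_const.
  by apply: ler_sum => r _; rewrite normcM ler_pM ?normc_ge0 // EB.
Qed.

End EulerMaclaurin.

(** * Exponentials of monomial phases *)

Section PolynomialPhase.
Variable R : realType.
Local Notation C := (R[i]%C).
Implicit Types (p q : {poly C}).

(** Functions p exp(q) are stable under differentiation; this is the induced operator on the
    polynomial factor. *)
Definition phase_deriv q p : {poly C} := p^`() + p * q^`().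

Definition phase_fun q p (t : R) : C := p.[t%:C%C] * cexp q.[t%:C%C].

Lemma is_cderive_phase_fun q p (t : R) :
  is_cderive (phase_fun q p) t (phase_fun q (phase_deriv q p) t).
Proof.
apply: is_cderive_eq.
  apply: is_cderiveM (is_cderive_horner p t) _.
  exact: is_cderive_cexp (is_cderive_horner q t).
rewrite /phase_fun /phase_deriv hornerD hornerM; ring.
Qed.

(* Differentiation costs a factor [n / X] in this norm, and multiplication by
   ['X^k.-1] a factor [X ^+ k.-1]. *)
Definition coef_norm (X : R) (n : nat) p : R := \sum_(i < n) normc p`_i * X ^+ i.

Lemma normc_horner_le (X t : R) n p : 0 <= t <= X -> (size p <= n)%N ->
  normc p.[t%:C%C] <= coef_norm X n p.
Proof.
move=> /andP[t0 tX] pn; rewrite (horner_coef_wide _ pn).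
apply: le_trans (ler_normc_sum _ _ _) _; apply: ler_sum => i _.
rewrite normcM normcX normc_real ger0_norm // ler_wpM2l ?normc_ge0 //.
by rewrite lerXn2r ?nnegrE // (le_trans t0).
Qed.

Lemma coef_norm_wide (X : R) n m p : (size p <= n)%N -> (n <= m)%N ->
  coef_norm X m p = coef_norm X n p.
Proof.
move=> pn /subnKC <-; rewrite /coef_norm big_split_ord /=.
rewrite [X in _ + X]big1 ?addr0 // => i _.
by rewrite nth_default ?normc0 ?mul0r // (leq_trans pn) ?leq_addr.
Qed.

Lemma coef_norm_ge0 (X : R) n p : 0 <= X -> 0 <= coef_norm X n p.
Proof.
by move=> X0; apply: sumr_ge0 => i _; rewrite mulr_ge0 ?normc_ge0 ?exprn_ge0.
Qed.

Variables (k : nat) (tau : C).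
Hypothesis k_gt0 : (0 < k)%N.

Definition pow_phase : {poly C} := - (tau *: 'X^k).

Lemma deriv_pow_phase : pow_phase^`() = - ((k%:R * tau) *: 'X^(k.-1)).
Proof.
by rewrite /pow_phase derivN derivZ derivXn -scaler_nat scalerA mulrC.
Qed.

Lemma size_phase_deriv n p : (size p <= n.+1)%N ->
  (size (phase_deriv pow_phase p) <= (n + k.-1).+1)%N.
Proof.
move=> pn; apply: leq_trans (size_polyD _ _) _; rewrite geq_max.
rewrite (leq_trans (size_poly _ _)) /=; last first.
  by rewrite (leq_trans (leq_pred _)) // (leq_trans pn) // ltnS leq_addr.
rewrite deriv_pow_phase mulrN size_polyN -scalerAr.
apply: leq_trans (size_scale_leq _ _) _.
have [->|p0] := eqVneq p 0; first by rewrite mul0r size_poly0.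
by rewrite size_mulXn // addnC -addSn leq_add2r.
Qed.

(** [kappa] dominates both rates of change on [0, X]: 1/X for the polynomial factor, with its degree
    as multiplier, and |tau| X^(k-1) for the phase, with multiplier k. *)
Lemma coef_norm_phase_deriv (X kappa : R) n p : 0 < X -> (size p <= n.+1)%N ->
  X^-1 <= kappa -> normc tau * X ^+ k.-1 <= kappa ->
  coef_norm X (n + k.-1).+1 (phase_deriv pow_phase p)
    <= (n + k).+1%:R * kappa * coef_norm X n.+1 p.
Proof.
move=> X0 pn Xk tk; have X0' := ltW X0.
have N0 := coef_norm_ge0 n.+1 p X0'.
have kappa0 : 0 <= kappa by apply: le_trans Xk; rewrite invr_ge0.
apply: (@le_trans _ _ (coef_norm X (n + k.-1).+1 p^`()
    + coef_norm X (n + k.-1).+1 (p * pow_phase^`()))).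
  rewrite -big_split /=; apply: ler_sum => i _.
  by rewrite coefD -mulrDl ler_wpM2r ?exprn_ge0 // ler_normcD.
have h1 : coef_norm X (n + k.-1).+1 p^`() <= n.+1%:R * kappa * coef_norm X n.+1 p.
  apply: (@le_trans _ _ (n.+1%:R * X^-1 * coef_norm X (n + k.-1).+2 p)); last first.
    rewrite (coef_norm_wide _ pn); last by lia.
    by rewrite ler_wpM2r // ler_wpM2l.
  rewrite /coef_norm [in X in _ <= X]big_ord_recl /= mulrDr ler_wpDl //.
    by rewrite !mulr_ge0 ?invr_ge0 ?normc_ge0.
  rewrite mulr_sumr; apply: ler_sum => i _; rewrite /bump /= add1n.
  rewrite coef_deriv -[p`_i.+1 *+ _]mulr_natl normcM normc_nat.
  have [ni|ni] := leqP n.+1 i.+1.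
    by rewrite (nth_default 0 (leq_trans pn ni)) normc0 mulr0 !mul0r mulr0.
  rewrite exprS.
  have -> : n.+1%:R / X * (normc p`_i.+1 * (X * X ^+ i)) =
      n.+1%:R * (normc p`_i.+1 * X ^+ i) :> R by field; rewrite gt_eqF.
  rewrite -mulrA ler_wpM2r ?mulr_ge0 ?normc_ge0 ?exprn_ge0 //.
  by rewrite ler_nat ltnW.
have h2 : coef_norm X (n + k.-1).+1 (p * pow_phase^`())
    <= k%:R * kappa * coef_norm X n.+1 p.
  rewrite deriv_pow_phase /coef_norm addnC -addnS big_split_ord /= big1 => [|i _].
    rewrite add0r mulr_sumr; apply: ler_sum => i _.
    rewrite mulrN -scalerAr coefN coefZ coefMXn ltnNge leq_addr /= addKn.
    rewrite normc_opp !normcM normc_nat exprD.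
    have -> : k%:R * normc tau * normc p`_i * (X ^+ k.-1 * X ^+ i) =
      (normc tau * X ^+ k.-1) * (k%:R * (normc p`_i * X ^+ i)) by ring.
    have -> : k%:R * kappa * (normc p`_i * X ^+ i) =
      kappa * (k%:R * (normc p`_i * X ^+ i)) by ring.
    by rewrite ler_wpM2r // !mulr_ge0 ?normc_ge0 ?exprn_ge0.
  by rewrite mulrN -scalerAr coefN coefZ coefMXn ltn_ord mulr0 oppr0 normc0 mul0r.
have -> : (n + k).+1%:R * kappa * coef_norm X n.+1 p =
  n.+1%:R * kappa * coef_norm X n.+1 p + k%:R * kappa * coef_norm X n.+1 p.
  by rewrite -addSn natrD; ring.
exact: lerD.
Qed.

(** Hermite-type polynomials: the j-th derivative of exp(-tau t^k) is the j-th of them times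
    exp(-tau t^k). *)
Definition phase_poly (j : nat) : {poly C} := iter j (phase_deriv pow_phase) 1.

Lemma phase_poly_bound (X kappa : R) (J j : nat) : 0 < X ->
  X^-1 <= kappa -> normc tau * X ^+ k.-1 <= kappa -> (j <= J)%N ->
  (size (phase_poly j) <= (k * j).+1)%N /\
  coef_norm X (k * j).+1 (phase_poly j) <= ((k * J + k).+1%:R * kappa) ^+ j.
Proof.
move=> X0 Xk tk; have kappa0 : 0 <= kappa by rewrite (le_trans _ Xk) ?invr_ge0 ?ltW.
elim: j => [|j ih] jJ.
  rewrite muln0 /phase_poly /= size_poly1; split=> //.
  by rewrite /coef_norm big_ord1 coef1 normc_nat !expr0 mulr1.
have [s1 n1] := ih (ltnW jJ).
have s2 := size_phase_deriv s1.
have le1 : ((k * j + k.-1).+1 <= (k * j.+1).+1)%N.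
  by rewrite mulnS ltnS addnC leq_add2r leq_pred.
rewrite /phase_poly iterS -/(phase_poly j); split; first exact: leq_trans le1.
rewrite (coef_norm_wide _ s2 le1).
apply: le_trans (coef_norm_phase_deriv X0 s1 Xk tk) _.
rewrite exprS; apply: ler_pM => //; first by rewrite mulr_ge0.
  exact/coef_norm_ge0/ltW.
rewrite ler_wpM2r // ler_nat ltnS leq_add2r leq_mul2l.
by rewrite (ltnW jJ) orbT.
Qed.

Lemma phase_poly_le (X kappa t : R) (J j : nat) : 0 < X ->
  X^-1 <= kappa -> normc tau * X ^+ k.-1 <= kappa -> (j <= J)%N ->
  0 <= t <= X ->
  normc (phase_poly j).[t%:C%C] <= ((k * J + k).+1%:R * kappa) ^+ j.
Proof.
move=> X0 Xk tk jJ tX.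
have [s1 n1] := phase_poly_bound X0 Xk tk jJ.
exact: le_trans (normc_horner_le tX s1) n1.
Qed.

Lemma normc_cexp_phase (t : R) :
  normc (cexp pow_phase.[t%:C%C]) = expR (- (complex.Re tau * t ^+ k)).
Proof.
rewrite normc_cexp /pow_phase !hornerE -rmorphXn /=; congr expR.
by case: tau => a b /=; rewrite mulr0 subr0.
Qed.

Lemma normc_cexp_phase_le1 (t : R) : 0 <= complex.Re tau -> 0 <= t ->
  normc (cexp pow_phase.[t%:C%C]) <= 1.
Proof.
by move=> tau0 t0; rewrite normc_cexp_phase expR_le1 oppr_le0 mulr_ge0 ?exprn_ge0.
Qed.

(** The Leibniz rule for t exp(-tau t^k), where only the first derivative of the factor t
    survives. *)
Lemma iter_phase_derivX j : iter j (phase_deriv pow_phase) 'X =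
  'X * phase_poly j + j%:R * phase_poly j.-1.
Proof.
elim: j => [|j ih]; first by rewrite mul0r addr0 mulr1.
rewrite iterS ih /phase_deriv derivD !derivM derivX mul1r.
have -> : (j%:R : {poly C})^`() = 0 by rewrite -polyC_natr derivC.
rewrite mul0r add0r.
case: j {ih} => [|j].
  by rewrite !mul0r /phase_poly /= /phase_deriv; ring.
have e1 : phase_poly j.+1 = (phase_poly j)^`() + phase_poly j * pow_phase^`().
  by [].
have e2 : phase_poly j.+2 =
    (phase_poly j.+1)^`() + phase_poly j.+1 * pow_phase^`() by [].
have e3 : j.+2%:R = j.+1%:R + 1 :> {poly C} by rewrite natr1.
rewrite !succnK e2 e3.
have -> : (j.+1%:R + 1) * phase_poly j.+1 =
    j.+1%:R * phase_poly j.+1 + phase_poly j.+1 by rewrite mulrDl mul1r.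
by rewrite [X in _ = _ + (_ * X + _)]e1; ring.
Qed.

(** The function t exp(-tau t^k) vanishes at 0 and is at most [W] at n, so by Euler-Maclaurin
    summation its derivative sums to O(1). Here [la] bounds the gain per derivative. At order J,
    values up to n la^J + J la^(J-1) are added n times, which explains the condition with n^2. *)
Lemma sum_derivative_Xphase_le (n J : nat) (kappa W : R) :
  let la := (k * J + k).+1%:R * kappa in
  (0 < n)%N -> 0 <= complex.Re tau -> n%:R^-1 <= kappa ->
  normc tau * n%:R ^+ k.-1 <= kappa -> la <= 1 -> (1 < J)%N ->
  n%:R ^+ 2 * la ^+ J.-1 <= 1 ->
  n%:R * expR (- (complex.Re tau * n%:R ^+ k)) <= W ->
  normc (\sum_(m < n) phase_fun pow_phase (phase_deriv pow_phase 'X) m%:R)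
    <= 2 ^+ J.+1 * (2 * J%:R + 1 + W).
Proof.
move=> la n0 tau0 nk tk la1 J1 nJ nW.
have nR : 0 < n%:R :> R by rewrite ltr0n.
have kappa0 : 0 <= kappa by rewrite (le_trans _ nk) ?invr_ge0 ?ltW.
have la0 : 0 <= la by rewrite mulr_ge0.
have W0 : 0 <= W by rewrite (le_trans _ nW) // mulr_ge0 ?expR_ge0 // ltW.
pose F j := phase_fun pow_phase (iter j (phase_deriv pow_phase) 'X).
have F' j (t : R) : is_cderive (F j) t (F j.+1 t).
  by rewrite /F iterS; exact: is_cderive_phase_fun.
have FE j (t : R) : 0 <= t <= n%:R -> (j <= J)%N ->
    normc (F j t) <= (t * la ^+ j + j%:R * la ^+ j.-1) *
      normc (cexp pow_phase.[t%:C%C]).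
  move=> tn jJ; rewrite /F /phase_fun normcM ler_wpM2r ?normc_ge0 //.
  have t0 : 0 <= t by case/andP: tn.
  rewrite iter_phase_derivX !hornerE; apply: le_trans (ler_normcD _ _) _.
  rewrite -polyC_natr hornerC !normcM normc_real normc_nat ger0_norm //.
  apply: lerD; rewrite ler_wpM2l //; apply: (phase_poly_le nR) => //.
  exact: leq_trans (leq_pred _) jJ.
have laj j : la ^+ j <= 1 by rewrite exprn_ile1.
have E1 (t : R) : 0 <= t -> normc (cexp pow_phase.[t%:C%C]) <= 1.
  exact: normc_cexp_phase_le1.
have := @sum_derivative_le R F F' J n (J%:R + W) ((J%:R + 1) / n%:R) _ _ _ 1%N.
move=> h; apply: le_trans (h _ _ _ _) _ => {h}.
- by rewrite addr_ge0.
- move=> j jJ; split.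
    apply: le_trans (FE j 0 _ (ltnW jJ)) _; first by rewrite lexx ltW.
    rewrite mul0r add0r -[X in _ <= X]mulr1 ler_pM ?normc_ge0 ?E1 //.
      by rewrite mulr_ge0 ?exprn_ge0.
    apply: (@le_trans _ _ J%:R); last by rewrite lerDl.
    rewrite -[X in _ <= X]mulr1 ler_pM ?exprn_ge0 //.
    by rewrite ler_nat ltnW.
  apply: le_trans (FE j n%:R _ (ltnW jJ)) _; first by rewrite lexx ltW.
  rewrite mulrDl addrC; apply: lerD.
    rewrite -mulrA -[X in _ <= X]mulr1 ler_pM ?mulr_ge0 ?exprn_ge0 ?normc_ge0 //.
      by rewrite ler_nat ltnW.
    by rewrite -[X in _ <= X]mulr1 ler_pM ?exprn_ge0 ?normc_ge0 ?E1 // ltW.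
  rewrite normc_cexp_phase; apply: le_trans nW.
  rewrite ler_wpM2r ?expR_ge0 // -[X in _ <= X]mulr1 ler_wpM2l //.
- move=> t tn; have /andP[t0 tn'] := tn.
  apply: le_trans (FE J t tn (leqnn J)) _.
  apply: (@le_trans _ _ (t * la ^+ J + J%:R * la ^+ J.-1)).
    rewrite -[X in _ <= X]mulr1 ler_wpM2l ?E1 //.
    by rewrite addr_ge0 // mulr_ge0 ?exprn_ge0.
  rewrite ler_pdivlMr // mulrDl addrC.
  have n1 : 1 <= n%:R :> R by rewrite ler1n.
  apply: lerD.
    rewrite -mulrA -[X in _ <= X]mulr1 ler_wpM2l //.
    apply: le_trans nJ; rewrite mulrC ler_wpM2r ?exprn_ge0 //.
    by rewrite expr2 ler_peMr // ltW.
  apply: le_trans nJ; rewrite mulrAC expr2 ler_pM ?mulr_ge0 ?exprn_ge0 ?(ltW nR) //.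
    by rewrite ler_wpM2r // ltW.
  by rewrite -[X in la ^+ X](prednK (ltnW J1)) exprS ler_piMl ?exprn_ge0.
- by rewrite /= ltnW.
rewrite ler_wpM2l ?exprn_ge0 // mulrC divfK ?gt_eqF //; lra.
Qed.

(** Over a block of length [q] each derivative of the exponential gains [la], which is at most 1.
    Hence the boundary values are at most 1, the Taylor remainders add up to at most 2, and the
    bound sees the incomplete sums through [K] but not the size of [tau]. *)
Lemma sum_periodic_phase_le (c : nat -> C) (q Y J : nat) (K kappa : R) :
  let la := q%:R * ((k * J + k).+1%:R * kappa) in
  (0 < q)%N -> (0 < Y)%N -> (forall m, c (q + m)%N = c m) ->
  \sum_(r < q) c r = 0 ->
  (forall x, (x <= q)%N -> normc (\sum_(i < x) c i) <= K) ->
  (forall m, normc (c m) <= 2) ->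
  0 <= complex.Re tau -> (q * Y)%:R^-1 <= kappa ->
  normc tau * (q * Y)%:R ^+ k.-1 <= kappa -> la <= 1 ->
  (q * Y)%:R * la ^+ J <= 1 ->
  normc (\sum_(m < q * Y) c m * cexp pow_phase.[m%:R%:C%C])
    <= J%:R * 2 ^+ J.+2 * K * 2 + 2.
Proof.
move=> la q0 Y0 cper c0 cK c2 tau0 nk tk la1 nJ.
set n := (q * Y)%N in nk tk nJ *.
have n0 : (0 < n)%N by rewrite muln_gt0 q0.
have nR : 0 < n%:R :> R by rewrite ltr0n.
have kappa0 : 0 <= kappa by rewrite (le_trans _ nk) ?invr_ge0 ?ltW.
have la0 : 0 <= la by rewrite !mulr_ge0.
have K0 : 0 <= K by rewrite (le_trans _ (cK 0%N _)) ?normc_ge0.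
pose F j := phase_fun pow_phase (phase_poly j).
have F' j (t : R) : is_cderive (F j) t (F j.+1 t).
  by rewrite /F /phase_poly iterS; exact: is_cderive_phase_fun.
have FE j (t : R) : 0 <= t <= n%:R -> (j <= J)%N ->
    q%:R ^+ j * normc (F j t) <= la ^+ j.
  move=> tn jJ; rewrite /F /phase_fun normcM exprMn ler_wpM2l ?exprn_ge0 //.
  rewrite -[X in _ <= X]mulr1 ler_pM ?normc_ge0 //.
    exact: (phase_poly_le nR).
  by apply: normc_cexp_phase_le1 => //; case/andP: tn.
have laj j : la ^+ j <= 1 by rewrite exprn_ile1.
rewrite (eq_bigr (fun m : 'I_n => c m * F 0%N m%:R)) => [|m _]; last first.
  by rewrite /F /phase_fun /phase_poly /= hornerC mul1r.
have := @sum_periodic_smooth_le R c q K F J Y 1 (la ^+ J) q0 cper c0 cK c2 F'.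
rewrite -/n => h; apply: le_trans (h _ _ _) _ => {h}.
- by [].
- move=> j jJ; split; apply: le_trans (FE j _ _ (ltnW jJ)) _ => //.
    by rewrite lexx ltW.
  by rewrite lexx ltW.
- by move=> t tn; exact: FE.
apply: lerD; last by rewrite mulrCA -[X in _ <= X]mulr1 ler_wpM2l.
have A0 : 0 <= J%:R * 2 ^+ J.+2 * K.
  by apply: mulr_ge0 => //; apply: mulr_ge0 => //; exact: exprn_ge0.
apply: ler_wpM2l A0 _ _ _.
have : Y%:R * la ^+ J <= 1.
  apply: le_trans nJ; rewrite ler_wpM2r ?exprn_ge0 // ler_nat.
  by rewrite leq_pmull.
by move=> ?; lra.
Qed.

End PolynomialPhase.

(** * Rotation of the phase *)

Section Rotation.
Variable R : realType.
Local Notation C := (R[i]%C).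

Definition polar (rho phi : R) : C := Complex (rho * cos phi) (rho * sin phi).

Lemma normc_polar (rho phi : R) : 0 <= rho -> normc (polar rho phi) = rho.
Proof.
move=> rho0; rewrite /= !exprMn -mulrDr cos2Dsin2 mulr1 sqrtr_sqr.
by rewrite ger0_norm.
Qed.

Lemma polar_form (x y : R) : 0 < x -> exists rho phi : R,
  [/\ 0 <= rho, - (pi / 2) < phi < pi / 2 & Complex x y = polar rho phi].
Proof.
move=> x0; pose phi := atan (y / x).
have phi2 : - (pi / 2) < phi < pi / 2 by rewrite atan_gtNpi2 atan_ltpi2.
have c0 : 0 < cos phi by exact: cos_gt0_pihalf.
exists (x / cos phi), phi; split=> //; first by rewrite divr_ge0 // ltW.
rewrite /polar; congr Complex; first by rewrite divfK // gt_eqF.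
have := atanK (y / x); rewrite -/phi /tan => e.
rewrite mulrAC -mulrA e mulrC divfK // gt_eqF //.
Qed.

Lemma ler_cos_abs (theta phi : R) : `|theta| <= `|phi| -> `|phi| <= pi ->
  cos phi <= cos theta.
Proof.
move=> tp ppi; rewrite -[cos phi]cos_norm -[cos theta]cos_norm.
move: tp; rewrite le_eqVlt => /predU1P[->//|tp].
apply: ltW; rewrite ltr_cos // in_itv /= normr_ge0 //=.
exact: le_trans (ltW tp) ppi.
Qed.

Variables (k n : nat) (rho : R).
Hypothesis k_gt0 : (0 < k)%N.

(** The exponent i theta/k - rho exp(i theta) m^k. With a real variable t > 0 in place of m, the
    integral of its exponential does not depend on theta, which suggests that the sum over m is
    nearly constant. *)
Let u (m : nat) (theta : R) : C :=
  Complex (- (m%:R ^+ k * rho) * cos theta)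
          (k%:R^-1 * theta - m%:R ^+ k * rho * sin theta).

Let du (m : nat) (theta : R) : C :=
  Complex (m%:R ^+ k * rho * sin theta)
          (k%:R^-1 - m%:R ^+ k * rho * cos theta).

Lemma is_cderive_rotated_phase (m : nat) (theta : R) :
  is_cderive (u m) theta (du m theta).
Proof.
split => /=.
- apply: is_derive_eq (is_deriveZ _ (is_derive_cos theta)) _.
  by rewrite /GRing.scale /= mulNr mulrN opprK.
- apply: is_derive_eq (is_deriveB (is_deriveZ _ (is_derive_id theta (1 : R)))
    (is_deriveZ _ (is_derive_sin theta))) _.
  by rewrite /GRing.scale /= mulr1.
Qed.

Let h (theta : R) : C := \sum_(m < n) cexp (u m theta).

Lemma rotated_phaseE (m : nat) (theta : R) : cexp (u m theta) =
  cexp (Complex 0 (k%:R^-1 * theta)) *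
  cexp (pow_phase k (polar rho theta)).[m%:R%:C%C].
Proof.
rewrite -cexpD; congr cexp; rewrite /pow_phase !hornerE -rmorphXn /=.
by apply/eqP; rewrite eq_complex /=; apply/andP; split; apply/eqP; ring.
Qed.

(** With tau = rho exp(i theta), the derivative of the exponent in theta is (i/k)(1 - k tau m^k),
    and (1 - k tau t^k) exp(-tau t^k) is the derivative of t exp(-tau t^k). *)
Lemma rotated_sum_derivative (theta : R) :
  normc (\sum_(m < n) du m theta * cexp (u m theta)) <=
  normc (\sum_(m < n) phase_fun (pow_phase k (polar rho theta))
     (phase_deriv (pow_phase k (polar rho theta)) 'X) m%:R).
Proof.
set q := pow_phase _ _.
have -> : \sum_(m < n) du m theta * cexp (u m theta) =
  Complex 0 k%:R^-1 * cexp (Complex 0 (k%:R^-1 * theta)) *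
  \sum_(m < n) phase_fun q (phase_deriv q 'X) m%:R.
  rewrite mulr_sumr; apply: eq_bigr => m _.
  rewrite rotated_phaseE -/q.
  have -> : du m theta = Complex 0 k%:R^-1 * (phase_deriv q 'X).[m%:R%:C%C].
    rewrite /phase_deriv derivX /q deriv_pow_phase // hornerD hornerC hornerM.
    rewrite hornerX hornerN hornerZ hornerXn.
    have -> : (m%:R%:C%C * - (k%:R * polar rho theta * m%:R%:C%C ^+ k.-1) : C)
      = - (k%:R%:C%C * (m%:R ^+ k)%:C%C * polar rho theta).
      have -> : (m%:R ^+ k : R) = m%:R * m%:R ^+ k.-1 by rewrite -exprS prednK.
      rewrite rmorphM rmorphXn /=.
      have -> : (k%:R : C) = k%:R%:C%C by rewrite rmorph_nat.
      ring.
    apply/eqP; rewrite eq_complex /=; apply/andP; split; apply/eqP.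
      by field; rewrite pnatr_eq0 -lt0n.
    by field; rewrite pnatr_eq0 -lt0n.
  by rewrite /phase_fun; ring.
rewrite !normcM normc_cexp /= expR0 mulr1 expr0n /= add0r sqrtr_sqr.
rewrite ger0_norm ?invr_ge0 // ler_piMl ?normc_ge0 //.
by rewrite invf_le1 ?ltr0n // ler1n.
Qed.

(* The derivative of [h] at [theta] is a sum of the derivative of
   [t * exp (- tau t ^ k)] over the integers: the discrete counterpart of
   rotating the contour of the integral of [exp (- tau t ^ k)]. *)
Lemma rotate_phase_sum (phi M : R) :
  (forall theta, `|theta| <= `|phi| ->
     normc (\sum_(m < n) phase_fun (pow_phase k (polar rho theta))
       (phase_deriv (pow_phase k (polar rho theta)) 'X) m%:R) <= M) ->
  exists2 r : R, 0 <= rho -> 0 <= r <= n%:R &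
    normc (\sum_(m < n) cexp (pow_phase k (polar rho phi)).[m%:R%:C%C]
      - cexp (Complex 0 (- (k%:R^-1 * phi))) * r%:C%C) <= M * `|phi|.
Proof.
move=> dM; exists (\sum_(m < n) expR (- (m%:R ^+ k * rho))).
  move=> rho0.
  rewrite sumr_ge0 => [|m _]; last exact: expR_ge0.
  rewrite -[X in _ <= X%:R]card_ord -sumr_const; apply: ler_sum => m _.
  by rewrite expR_le1 oppr_le0 mulr_ge0 ?exprn_ge0.
have h' (theta : R) : is_cderive h theta (\sum_(m < n) du m theta * cexp (u m theta)).
  by apply: is_cderive_sum => m; apply/is_cderive_cexp/is_cderive_rotated_phase.
have dhM theta : `|theta| <= `|phi| ->
    normc (\sum_(m < n) du m theta * cexp (u m theta)) <= M.
  by move=> tp; apply: le_trans (rotated_sum_derivative _) (dM _ tp).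
have h0 : h 0 = (\sum_(m < n) expR (- (m%:R ^+ k * rho)))%:C%C.
  rewrite /h rmorph_sum; apply: eq_bigr => m _.
  rewrite -[RHS](cexp_real (- (m%:R ^+ k * rho))); congr cexp.
  by rewrite /u cos0 sin0 !mulr0 subr0 mulr1.
have -> : \sum_(m < n) cexp (pow_phase k (polar rho phi)).[m%:R%:C%C] =
    cexp (Complex 0 (- (k%:R^-1 * phi))) * h phi.
  rewrite /h mulr_sumr; apply: eq_bigr => m _; rewrite rotated_phaseE mulrA.
  rewrite -cexpD (_ : _ + _ = 0) ?cexp0 ?mul1r //.
  by apply/eqP; rewrite eq_complex /= addr0 addNr !eqxx.
rewrite -h0 -mulrBr normcM normc_cexp /= expR0 mul1r.
have [phi0|phi0] := leP 0 phi.
  have -> : `|phi| = phi - 0 by rewrite subr0 ger0_norm.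
  apply: (cmean_value phi0 (fun x _ => h' x)) => x /andP[x0 xp].
  by apply: dhM; rewrite !ger0_norm.
rewrite -normc_opp opprB.
have -> : `|phi| = 0 - phi by rewrite sub0r ltr0_norm.
apply: (cmean_value (ltW phi0) (fun x _ => h' x)) => x /andP[xp x0].
by apply: dhM; rewrite (ler0_norm x0) (ler0_norm (ltW phi0)) lerN2.
Qed.

End Rotation.

(** The even power removes the unknown sign of [g], and the remaining angle s phi/k stays within the
    range of [phi], where the cosine is nonnegative. *)
Lemma Re_rotated_expn_ge0 (R : realType) (k s : nat) (g r phi : R) :
  (0 < k)%N -> (s <= k)%N -> ~~ odd s -> - (pi / 2) < phi < pi / 2 ->
  0 <= complex.Re ((g%:C%C * (cexp (Complex 0 (- (k%:R^-1 * phi))) * r%:C%C)) ^+ s).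
Proof.
move=> k0 sk sev /andP[p1 p2].
rewrite mulrCA mulrC -rmorphM exprMn -rmorphXn -cexpMn Re_realM.
apply: mulr_ge0; first by rewrite -(even_halfK sev) -mul2n exprM exprn_ge0 // sqr_ge0.
have -> : (Complex 0 (- (k%:R^-1 * phi)) : R[i]%C) *+ s =
    Complex 0 (- (s%:R / k%:R * phi)).
  apply/eqP; rewrite eq_complex; apply/andP; split.
    by elim: s {sk sev} => [|s ih]; rewrite ?mulr0n // mulrS ReD (eqP ih) addr0.
  elim: s {sk sev} => [|s ih]; first by rewrite mulr0n !mul0r oppr0.
  rewrite mulrS ImD (eqP ih) /=; apply/eqP; rewrite -natr1; ring.
rewrite /= expR0 mul1r cosN; apply: cos_ge0_pihalf.
have a0 : 0 <= s%:R / k%:R :> R by rewrite divr_ge0.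
have a1 : s%:R / k%:R <= 1 :> R by rewrite ler_pdivrMr ?ltr0n // mul1r ler_nat.
move: (s%:R / k%:R) a0 a1 => a a0 a1.
have pp := @pi_gt0 R; nra.
Qed.

(** * Rational approximation, Gauss sums and Weyl sums *)

Section DirichletApproximation.
Variable R : realType.

Let frac (x : R) : R := x - (Num.floor x)%:~R.

Lemma frac_itv (x : R) : 0 <= frac x < 1.
Proof.
have /andP[h1 h2] := floor_itv x; rewrite /frac subr_ge0 h1 /=.
by rewrite ltrBlDl -intrD1.
Qed.

Lemma dirichlet_pigeonhole (alpha : R) (n : nat) : (0 < n)%N ->
  exists (q : nat) (a : int),
    (0 < q <= n)%N /\ `|q%:R * alpha - a%:~R| <= n%:R^-1.
Proof.
case: n => // n _; pose N := n.+1.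
pose y (i : nat) := N%:R * frac (i%:R * alpha).
have y0 i : 0 <= y i by rewrite mulr_ge0 //; case/andP: (frac_itv (i%:R * alpha)).
have yN i : y i < N%:R.
  rewrite -[X in _ < X]mulr1 ltr_pM2l ?ltr0n //.
  by case/andP: (frac_itv (i%:R * alpha)).
pose f (i : 'I_N.+1) : 'I_N := inord (Num.truncn (y i)).
have fE i : f i = Num.truncn (y i) :> nat.
  by rewrite inordK // truncn_lt_nat.
have : ~ injective f.
  by move=> /leq_card; rewrite !card_ord ltnn.
move=> ninj; have [i [j [fij ij]]] : exists i j, f i = f j /\ (i < j)%N.
  apply: contrapT => h; apply: ninj => i j fij; apply: ord_inj.
  by case: (ltngtP i j) => // lt; exfalso; apply: h; [exists i, j | exists j, i].
exists (j - i)%N, (Num.floor (j%:R * alpha) - Num.floor (i%:R * alpha)).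
split; first by rewrite subn_gt0 ij /= (leq_trans (leq_subr _ _)) // -ltnS ltn_ord.
have -> : (j - i)%:R * alpha -
    (Num.floor (j%:R * alpha) - Num.floor (i%:R * alpha))%:~R =
    frac (j%:R * alpha) - frac (i%:R * alpha).
  rewrite (natrB _ (ltnW ij)) intrB /frac.
  by move: (Num.floor _) (Num.floor _) => u v; ring.
have /andP[i1 i2] := truncn_itv (y0 i).
have /andP[j1 j2] := truncn_itv (y0 j).
move: (congr1 val fij); rewrite /= !fE => e; rewrite e in i1 i2.
rewrite -natr1 in i2; rewrite -natr1 in j2.
have N0 : 0 < N%:R :> R by rewrite ltr0n.
rewrite -div1r ler_pdivlMr // -[X in `|_| * X](gtr0_norm N0) -normrM mulrC.
rewrite mulrBr -/(y i) -/(y j) ler_norml; lra.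
Qed.

Lemma dirichlet_approx (alpha : R) (n : nat) : (0 < n)%N ->
  exists (q : nat) (a : int), [/\ (0 < q <= n)%N, coprimez a q%:Z
    & `|alpha - a%:~R / q%:R| <= (q%:R * n%:R)^-1].
Proof.
move=> n0; have [q0 [a0 [qn0 qa0]]] := dirichlet_pigeonhole alpha n0.
(* The least admissible denominator is automatically coprime to its numerator. *)
pose P (q : nat) := (0 < q <= n)%N &&
  `[< exists a : int, `|q%:R * alpha - a%:~R| <= n%:R^-1 >].
have exP : exists q, P q by exists q0; rewrite /P qn0; apply/asboolP; exists a0.
case: (ex_minnP exP) => q /andP[qn /asboolP[a qa]] qmin.
have qp : (0 < q)%N by case/andP: qn.
have qR : 0 < q%:R :> R by rewrite ltr0n.
exists q, a; split=> //; last first.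
  rewrite invfM [X in _ <= X]mulrC ler_pdivlMr //.
  rewrite -[X in _ * X <= _](gtr0_norm qR) -normrM.
  by rewrite mulrBl divfK ?gt_eqF // mulrC.
pose d := gcdz a q%:Z.
have d0 : (0 < `|d|)%N.
  by rewrite lt0n absz_eq0 gcdz_eq0 negb_and; apply/orP; right; rewrite -lt0n.
have dq : (d %| q%:Z)%Z by exact: dvdz_gcdr.
have da : (d %| a)%Z by exact: dvdz_gcdl.
have dE : d = `|d|%N%:Z by rewrite gez0_abs // gcdz_ge0.
have [q' q'E] : exists q', q = (q' * `|d|)%N.
  by exists (q %/ `|d|)%N; rewrite divnK // -dvdzE.
have [a' a'E] : exists a' : int, a = a' * d by apply/dvdzP.
have q'0 : (0 < q')%N by move: qp; rewrite q'E muln_gt0 => /andP[].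
have : (q <= q')%N.
  apply: qmin; rewrite /P q'0 /=; apply/andP; split.
    by case/andP: qn => _; apply: leq_trans; rewrite q'E leq_pmulr.
  apply/asboolP; exists a'.
  apply: le_trans qa; rewrite {1}a'E {1}q'E dE natrM intrM -mulrAC -mulrBl normrM.
  by rewrite ler_peMr // ger0_norm // ler1n.
rewrite {1}q'E -[X in (_ <= X)%N]muln1 leq_pmul2l // => d1.
by rewrite /coprimez -/d dE; apply/eqP; congr Posz; lia.
Qed.

End DirichletApproximation.

Section GaussSum.
Variable R : realType.
Local Notation C := (R[i]%C).
Variables (k q : nat) (a : int).
Hypothesis q_gt0 : (0 < q)%N.

Definition gauss_term (m : nat) : C := e_circle (a%:~R / q%:R * m%:R ^+ k).

Let qR : (q%:R : R) != 0.
Proof. by rewrite pnatr_eq0 -lt0n. Qed.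

Lemma e_circle_modn (N : nat) : e_circle (a%:~R / q%:R * N%:R : R) =
  e_circle (a%:~R / q%:R * (N %% q)%:R).
Proof.
rewrite {1}(divn_eq N q) natrD natrM mulrDr e_circleD.
have -> : a%:~R / q%:R * ((N %/ q)%:R * q%:R) = (a * (N %/ q)%:Z)%:~R :> R.
  by rewrite intrM /=; field.
by rewrite e_circle_int mul1r.
Qed.

Lemma gauss_term_periodic (m : nat) : gauss_term (q + m) = gauss_term m.
Proof.
rewrite /gauss_term -!natrX e_circle_modn [RHS]e_circle_modn.
by rewrite -modnXm modnDl modnXm.
Qed.

Lemma normc_gauss_term m : normc (gauss_term m) = 1.
Proof. exact: normc_e_circle. Qed.

Lemma sum_gauss_term_shift :
  \sum_(r < q) gauss_term r.+1 = \sum_(r < q) gauss_term r.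
Proof.
apply: (@addrI _ (gauss_term 0)).
have -> : gauss_term 0 + \sum_(r < q) gauss_term r.+1 = \sum_(r < q.+1) gauss_term r.
  by rewrite big_ord_recl.
rewrite big_ord_recr /= addrC; congr (_ + _).
by rewrite -[in LHS](addn0 q) gauss_term_periodic.
Qed.

(** Taking the real part loses nothing for odd [k], by [gauss_mean_real]. *)
Definition gauss_mean : R := complex.Re (\sum_(r < q) gauss_term r) / q%:R.

(* [r ^ k + (q - r) ^ k] is divisible by [q] because [k] is odd. *)
Lemma conj_gauss_term (r : nat) : odd k -> (r <= q)%N ->
  ((gauss_term r)^*)%C = gauss_term (q - r).
Proof.
move=> k_odd rq; rewrite /gauss_term -e_circleN.
have -> : a%:~R / q%:R * (q - r)%:R ^+ k =
    (a * \sum_(i < k) ((q - r)%:Z ^+ (k.-1 - i) * (- r%:Z) ^+ i))%:~R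
    - a%:~R / q%:R * r%:R ^+ k :> R.
  have : ((q - r)%:Z ^+ k - (- r%:Z) ^+ k)%:~R =
     (q%:Z * \sum_(i < k) ((q - r)%:Z ^+ (k.-1 - i) * (- r%:Z) ^+ i))%:~R :> R.
    rewrite subrXX; congr (_%:~R); congr (_ * _).
    by rewrite opprK -PoszD subnK.
  rewrite exprNn -signr_odd k_odd expr1 mulN1r opprK intrD !rmorphXn /= => e.
  rewrite !intrM in e *; rewrite -[_%:Z%:~R]/((q - r)%:R) in e.
  apply: (mulfI qR); rewrite mulrBr.
  rewrite [q%:R * (a%:~R * _)]mulrCA -[q%:R]/(q%:Z%:~R) -e; field.
  by [].
by rewrite e_circleD e_circle_int mul1r.
Qed.

Lemma gauss_mean_real : odd k ->
  \sum_(r < q) gauss_term r = (q%:R * gauss_mean)%:C%C.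
Proof.
move=> k_odd; set S := \sum_(r < q) _.
suff SJ : (S^*)%C = S.
  rewrite /gauss_mean -/S mulrC divfK //.
  by move: SJ; case: (S) => x y /= [] /eqP; rewrite eq_sym -subr_eq0 opprK
    -mulr2n mulrn_eq0 /= => /eqP ->.
rewrite /S rmorph_sum /=.
rewrite (eq_bigr (fun r : 'I_q => gauss_term (q - r))) => [|r _]; last first.
  by apply: conj_gauss_term => //; exact: ltnW.
(* The reversal sends r to q - 1 - r, so the index q - r becomes r + 1; the shift by one is then
   undone by periodicity. *)
rewrite (reindex_inj rev_ord_inj) /= -sum_gauss_term_shift.
by apply: eq_bigr => r _; rewrite subKn.
Qed.

Lemma gauss_mean_le1 : `|gauss_mean| <= 1.
Proof.
rewrite /gauss_mean normrM normfV normr_nat ler_pdivrMr ?ltr0n // mul1r.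
apply: le_trans (normr_Re_le _) _; apply: le_trans (ler_normc_sum _ _ _) _.
rewrite -[X in _ <= X%:R]card_ord -sumr_const.
by apply: ler_sum => r _; rewrite normc_gauss_term.
Qed.

End GaussSum.

Lemma le_powR2 (R : realType) (r x y : R) :
  0 <= r -> 0 <= x -> x <= y -> x `^ r <= y `^ r.
Proof.
move=> r0 x0 xy; apply: (ge0_ler_powR r0) => //; rewrite nnegrE //.
exact: le_trans xy.
Qed.

Section WeylSums.
Variable R : realType.
Local Notation C := (R[i]%C).
Variables (k : nat) (sigma delta : R) (Cw : R).
Hypothesis k_gt2 : (2 < k)%N.
Hypothesis sigma_gt0 : 0 < sigma.
Hypothesis sigma_le : sigma <= 1 / 2.
Hypothesis delta_gt0 : 0 < delta.
Hypothesis Cw_ge1 : 1 <= Cw.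

Definition monomial_sum (alpha : R) (n : nat) : C :=
  \sum_(m < n) e_circle (alpha * m.+1%:R ^+ k).

Lemma weyl_sum_natr (alpha : R) (n : nat) :
  weyl_sum k alpha n%:R = monomial_sum alpha n.
Proof. by rewrite /weyl_sum natrK big_add1 /= big_mkord. Qed.

(** Kept apart from [weyl_admissible] because it is needed for a lowered exponent, at one [delta]
    and with its constant [Cw] fixed. *)
Definition weyl_bound : Prop := forall (n : nat) (alpha : R) (a : int) (q : nat),
  (0 < n)%N -> (0 < q)%N -> coprimez a q%:Z ->
  `|alpha - a%:~R / q%:R| <= q%:R ^- 2 ->
  normc (monomial_sum alpha n) <= Cw * (n%:R `^ (1 + delta)
     * (q%:R^-1 + n%:R^-1 + q%:R / n%:R ^+ k) `^ sigma).

Hypothesis wb : weyl_bound.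

Lemma monomial_sum_trivial (alpha : R) n : normc (monomial_sum alpha n) <= n%:R.
Proof.
apply: le_trans (ler_normc_sum _ _ _) _.
rewrite -[X in _ <= X%:R]card_ord -sumr_const.
by apply: ler_sum => r _; rewrite normc_e_circle.
Qed.

(** The Weyl bound is used exactly at a/q. If q <= n^(k-1), all three terms of its base are at most
    1/n. Otherwise n^2 <= n^(k-1) < q since k >= 3, and the trivial bound n <= q^(1/2) suffices
    because sigma <= 1/2. *)
Lemma gauss_incomplete_le (a : int) (q n : nat) : (0 < q)%N -> coprimez a q%:Z ->
  (n <= q)%N ->
  normc (monomial_sum (a%:~R / q%:R) n) <= 3 * Cw * q%:R `^ (1 - sigma + delta).
Proof.
move=> q0 aq nq.
have Cw0 : 0 < Cw by apply: lt_le_trans Cw_ge1.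
have qp : 1 <= q%:R :> R by rewrite ler1n.
have e0 : 0 <= 1 - sigma + delta by move: sigma_le delta_gt0 => *; lra.
have [->|n0] := posnP n.
  by rewrite /monomial_sum big_ord0 normc0 !mulr_ge0 ?powR_ge0 // ltW.
have nR : 0 < n%:R :> R by rewrite ltr0n.
have nqR : n%:R <= q%:R :> R by rewrite ler_nat.
have [nk|nk] := leqP q (n ^ k.-1).
  apply: le_trans (wb n0 q0 aq _) _; first by rewrite subrr normr0 invr_ge0 exprn_ge0.
  rewrite [3 * Cw]mulrC -mulrA ler_wpM2l ?(ltW Cw0) //.
  apply: (@le_trans _ _ (n%:R `^ (1 + delta) * (3 * n%:R `^ (- sigma)))).
    rewrite ler_wpM2l ?powR_ge0 //.
    apply: (@le_trans _ _ ((3 * n%:R^-1) `^ sigma)).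
      apply: le_powR2; first exact: ltW.
        by rewrite !addr_ge0 ?divr_ge0 ?invr_ge0 ?exprn_ge0.
      have h1 : q%:R^-1 <= n%:R^-1 :> R by rewrite lef_pV2 ?posrE ?ltr0n.
      have h2 : q%:R / n%:R ^+ k <= n%:R^-1 :> R.
        have -> : (n%:R ^+ k : R) = n%:R ^+ k.-1 * n%:R.
          by rewrite -exprSr prednK // ltnW // ltnW.
        rewrite invfM mulrA ler_pdivrMr // mulVf ?gt_eqF //.
        by rewrite ler_pdivrMr ?exprn_gt0 // mul1r -natrX ler_nat.
      lra.
    rewrite powRM ?invr_ge0 // -powR_inv1 // -powRrM mulN1r.
    rewrite ler_wpM2r ?powR_ge0 // -[X in _ <= X]powRr1 // ler_powR //.
      by rewrite ler1n.
    by move: sigma_le => *; lra.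
  rewrite mulrCA -powRD; last by rewrite (gt_eqF nR) implybT.
  rewrite ler_wpM2l // (_ : 1 + delta - sigma = 1 - sigma + delta); last by ring.
  exact: le_powR2.
apply: le_trans (monomial_sum_trivial _ _) _.
apply: (@le_trans _ _ (q%:R `^ (1 - sigma + delta))); last first.
  rewrite ler_peMl ?powR_ge0 //.
  by move: Cw_ge1 => *; lra.
apply: (@le_trans _ _ (q%:R `^ (2^-1))); last first.
  by apply: ler_powR => //; move: sigma_le delta_gt0 => *; lra.
have n2q : n%:R ^+ 2 <= q%:R :> R.
  rewrite -natrX ler_nat ltnW // (leq_ltn_trans _ nk) // leq_pexp2l //; lia.
have -> : n%:R = (n%:R ^+ 2) `^ 2^-1 :> R.
  by rewrite powR12_sqrt ?exprn_ge0 // sqrtr_sqr ger0_norm.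
by apply: le_powR2; rewrite ?exprn_ge0 ?invr_ge0.
Qed.

End WeylSums.

(** * Minor arcs *)

Section MinorArcs.
Variable R : realType.
Local Notation C := (R[i]%C).
Variables (k : nat) (sigma delta : R) (Cw : R).
Hypothesis k_gt2 : (2 < k)%N.
Hypothesis sigma_gt0 : 0 < sigma.
Hypothesis sigma_le : sigma <= 1 / 2.
Hypothesis delta_gt0 : 0 < delta.
Hypothesis Cw_ge1 : 1 <= Cw.
Hypothesis wb : weyl_bound k sigma delta Cw.

Let k_gt1 : (1 < k)%N. Proof. exact: ltnW. Qed.
Let k_gt0 : (0 < k)%N. Proof. exact: ltnW. Qed.

Definition damped_weight (P m : nat) : R := expR (- (m%:R ^+ k / P%:R ^+ k)).

Definition damped_sum (P L : nat) (alpha : R) : C :=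
  \sum_(m < L) (damped_weight P m.+1)%:C%C * e_circle (alpha * m.+1%:R ^+ k).

Lemma damped_weight_ge0 P m : 0 <= damped_weight P m.
Proof. exact: expR_ge0. Qed.

Lemma damped_weight_anti P m n : (m <= n)%N -> damped_weight P n <= damped_weight P m.
Proof.
move=> mn; rewrite ler_expR lerN2 ler_wpM2r ?invr_ge0 ?exprn_ge0 //.
by rewrite lerXn2r ?nnegrE // ler_nat.
Qed.

Lemma damped_weight_le1 P m : damped_weight P m <= 1.
Proof. by rewrite expR_le1 oppr_le0 divr_ge0 ?exprn_ge0. Qed.

Lemma damped_weight_increment P m : (0 < P)%N ->
  damped_weight P m - damped_weight P m.+1 <= (k%:R * m.+1%:R ^+ k.-1) / P%:R ^+ k.
Proof.
move=> P0; rewrite /damped_weight.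
pose d : R := (m.+1%:R ^+ k - m%:R ^+ k) / P%:R ^+ k.
have -> : - (m.+1%:R ^+ k / P%:R ^+ k) = - (m%:R ^+ k / P%:R ^+ k) + - d :> R.
  by rewrite /d; ring.
have mle : m%:R ^+ k <= m.+1%:R ^+ k :> R.
  by rewrite lerXn2r ?nnegrE // ler_nat.
have d0 : 0 <= d by rewrite divr_ge0 ?subr_ge0 ?exprn_ge0.
have dk : d <= (k%:R * m.+1%:R ^+ k.-1) / P%:R ^+ k.
  rewrite ler_wpM2r ?invr_ge0 ?exprn_ge0 // subrXX.
  have -> : m.+1%:R - m%:R = 1 :> R by rewrite -natr1 addrC addKr.
  have -> : k%:R * m.+1%:R ^+ k.-1 = \sum_(i < k) m.+1%:R ^+ k.-1 :> R.
    by rewrite sumr_const card_ord mulr_natl.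
  rewrite mul1r; apply: ler_sum => i _.
  have {2}-> : k.-1 = (k.-1 - i + i)%N by rewrite subnK // -ltnS prednK.
  rewrite exprD ler_wpM2l ?exprn_ge0 // lerXn2r ?nnegrE // ler_nat //.
apply: le_trans dk; rewrite expRD -[X in X - _]mulr1 -mulrBr.
have e1 := damped_weight_le1 P m.
have e0 := damped_weight_ge0 P m.
rewrite /damped_weight in e0 e1.
have h := expR_ge1Dx (- d).
rewrite -[X in _ <= X]mul1r; apply: ler_pM => //; last by lra.
by rewrite subr_ge0 expR_le1 oppr_le0.
Qed.

(* The loss [(L / x) ^+ k.-1] is absorbed by the increments of the weights. *)
Lemma monomial_sum_rescale (alpha : R) (a : int) (q x L : nat) :
  (0 < q)%N -> coprimez a q%:Z -> `|alpha - a%:~R / q%:R| <= q%:R ^- 2 ->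
  (0 < x <= L)%N ->
  normc (monomial_sum k alpha x) <= Cw * L%:R `^ (1 + delta) *
    (q%:R^-1 + L%:R^-1 + q%:R / L%:R ^+ k) `^ sigma * (L%:R / x%:R) ^+ k.-1.
Proof.
move=> q0 aq aqd /andP[x0 xL].
have xR : 0 < x%:R :> R by rewrite ltr0n.
have LR : 0 < L%:R :> R by rewrite ltr0n (leq_trans x0).
have xLR : x%:R <= L%:R :> R by rewrite ler_nat.
have Cw0 : 0 <= Cw by apply: le_trans Cw_ge1.
apply: le_trans (wb x0 q0 aq aqd) _.
rewrite -!mulrA ler_wpM2l //; apply: ler_pM; rewrite ?powR_ge0 //.
  apply: le_powR2 => //.
  by move: delta_gt0 => *; lra.
set Th := q%:R^-1 + L%:R^-1 + _; set t := L%:R / x%:R.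
have Th0 : 0 <= Th by rewrite !addr_ge0 ?divr_ge0 ?invr_ge0 ?exprn_ge0.
have t1 : 1 <= t by rewrite ler_pdivlMr // mul1r.
have tk : t <= t ^+ k by rewrite -[X in X <= _]expr1 ler_weXn2l.
have le1 : q%:R^-1 + x%:R^-1 + q%:R / x%:R ^+ k <= Th * t ^+ k.
  rewrite /Th !mulrDl; apply: lerD; first apply: lerD.
  - by rewrite ler_peMr ?invr_ge0 // exprn_ege1.
  - have -> : x%:R^-1 = L%:R^-1 * t :> R by rewrite /t mulrA mulVf ?gt_eqF ?mul1r.
    by rewrite ler_wpM2l ?invr_ge0.
  - by rewrite /t expr_div_n mulrA divfK ?gt_eqF ?exprn_gt0.
apply: le_trans (le_powR2 (ltW sigma_gt0) _ le1) _.
  by rewrite !addr_ge0 ?divr_ge0 ?invr_ge0 ?exprn_ge0.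
have t0 : 0 <= t by apply: le_trans t1.
rewrite powRM ?exprn_ge0 //.
rewrite ler_wpM2l ?powR_ge0 // -!powR_mulrn //.
(* The exponent comparison is k sigma <= k/2 <= k - 1. *)
rewrite -powRrM ler_powR // -subn1 natrB //.
have k3 : 3 <= k%:R :> R by rewrite ler_nat.
by move: sigma_le sigma_gt0 k3 => *; nra.
Qed.

(** Summation by parts: up to the constant k 2^(k-1), an increment of the weight times the rescaling
    loss (L/m)^(k-1) is at most L^(k-1)/P^k, and L of these add up to D^k. The two conditions on [q]
    bound each term of the Weyl base by D^(k+1)/P. The exponent 2k + 4 collects k from the weights,
    k + 1 from the base and 3 from L^(1+delta) <= P D^3. *)
Lemma damped_sum_minor (alpha : R) (a : int) (q P D : nat) :
  (0 < q)%N -> coprimez a q%:Z -> `|alpha - a%:~R / q%:R| <= q%:R ^- 2 ->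
  (0 < D <= P)%N -> P%:R `^ delta <= D%:R ->
  (P <= q * D ^ k.+1)%N -> (q <= P ^ k.-1 * D ^ k.+1)%N ->
  normc (damped_sum P (P * D) alpha) <=
   (3 * Cw * k%:R * 2 ^+ k) * (P%:R * P%:R `^ (- sigma)) * D%:R ^+ (2 * k + 4).
Proof.
move=> q0 aq aqd /andP[D0 DP] PD qP qQ.
have P0 : (0 < P)%N by exact: leq_trans DP.
have k0 := k_gt0.
have Cw0 : 0 <= Cw by apply: le_trans Cw_ge1.
have DR : 1 <= D%:R :> R by rewrite ler1n.
have PR : 1 <= P%:R :> R by rewrite ler1n.
have DR0 : 0 < D%:R :> R by rewrite ltr0n.
have PR0 : 0 < P%:R :> R by rewrite ltr0n.
have qR0 : 0 < q%:R :> R by rewrite ltr0n.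
set L := (P * D)%N; have L0 : (0 < L)%N by rewrite muln_gt0 P0.
have LR : 0 < L%:R :> R by rewrite ltr0n.
have LE : L%:R = P%:R * D%:R :> R by rewrite natrM.
set Th : R := q%:R^-1 + L%:R^-1 + q%:R / L%:R ^+ k.
pose T := Cw * L%:R `^ (1 + delta) * Th `^ sigma.
have T0 : 0 <= T by rewrite !mulr_ge0 ?powR_ge0.
pose c m : C := e_circle (alpha * m.+1%:R ^+ k).
pose u m : R := damped_weight P m.+1.
have cT x : (0 < x <= L)%N -> normc (\sum_(m < x) c m) <= T * (L%:R / x%:R) ^+ k.-1.
  by move=> xL; exact: (monomial_sum_rescale q0 aq aqd xL).
have step1 : normc (damped_sum P L alpha) <= T * (1 + k%:R * 2 ^+ k.-1 * D%:R ^+ k).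
  have -> : damped_sum P L alpha = \sum_(m < L) c m * (u m)%:C%C.
    by apply: eq_bigr => m _; rewrite mulrC.
  have cTL := cT L; rewrite leqnn andbT divff ?gt_eqF // expr1n mulr1 in cTL.
  move: cTL cT; rewrite -(prednK L0) => cTL cT.
  rewrite (@sum_by_parts _ c (fun m => (u m)%:C%C)) mulrDr mulr1.
  apply: le_trans (ler_normcD _ _) _; apply: lerD.
    rewrite normcM normc_real ger0_norm ?damped_weight_ge0 //.
    rewrite -[X in _ <= X]mulr1 ler_pM ?normc_ge0 ?damped_weight_ge0 //.
      exact: cTL.
    exact: damped_weight_le1.
  apply: le_trans (ler_normc_sum _ _ _) _.
  apply: (@le_trans _ _ (\sum_(m < L.-1) T * (k%:R * 2 ^+ k.-1 * L%:R ^+ k.-1 / P%:R ^+ k))).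
    apply: ler_sum => m _; rewrite normcM -rmorphB normc_real.
    rewrite ger0_norm ?subr_ge0 ?damped_weight_anti //.
    have mL : (m.+1 <= L.-1.+1)%N by rewrite ltnS ltnW.
    have m0 : 0 < m.+1%:R :> R by rewrite ltr0n.
    apply: le_trans (ler_pM (normc_ge0 _) _ (cT m.+1 mL)
      (damped_weight_increment m.+1 P0)) _.
      by rewrite subr_ge0 damped_weight_anti.
    have -> : T * (L.-1.+1%:R / m.+1%:R) ^+ k.-1 *
        (k%:R * m.+2%:R ^+ k.-1 / P%:R ^+ k) =
      (T * (k%:R * (L%:R ^+ k.-1 / P%:R ^+ k))) * (m.+2%:R / m.+1%:R) ^+ k.-1 :> R.
      by rewrite prednK // !expr_div_n; ring.
    have -> : T * (k%:R * 2 ^+ k.-1 * L%:R ^+ k.-1 / P%:R ^+ k) =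
      (T * (k%:R * (L%:R ^+ k.-1 / P%:R ^+ k))) * 2 ^+ k.-1 by ring.
    have A0 : 0 <= T * (k%:R * (L%:R ^+ k.-1 / P%:R ^+ k)).
      apply: (mulr_ge0 T0); apply: (mulr_ge0 (ler0n _ k)).
      exact: (divr_ge0 (exprn_ge0 _ (ltW LR)) (exprn_ge0 _ (ltW PR0))).
    apply: (ler_wpM2l A0); rewrite lerXn2r ?nnegrE ?divr_ge0 // ler_pdivrMr // -natrM ler_nat.
    by rewrite mul2n -addnn addSn ltnS addnS ltnS leq_addl.
  rewrite sumr_const card_ord -[X in X <= _]mulr_natl.
  rewrite mulrCA ler_wpM2l //.
  have -> : D%:R ^+ k = L%:R * L%:R ^+ k.-1 / P%:R ^+ k :> R.
    rewrite -exprS prednK // LE exprMn mulrAC divff ?mul1r //.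
    by rewrite gt_eqF ?exprn_gt0.
  have -> : k%:R * 2 ^+ k.-1 * (L%:R * L%:R ^+ k.-1 / P%:R ^+ k) =
     L%:R * (k%:R * 2 ^+ k.-1 * L%:R ^+ k.-1 / P%:R ^+ k) :> R by ring.
  rewrite ler_wpM2r ?divr_ge0 ?mulr_ge0 ?exprn_ge0 // ler_nat; exact: leq_pred.
apply: le_trans step1 _.
have ThB : Th <= 3 * D%:R ^+ k.+1 / P%:R.
  have B1 : 1 <= D%:R ^+ k.+1 :> R by rewrite exprn_ege1.
  have h1 : q%:R^-1 <= D%:R ^+ k.+1 / P%:R :> R.
    rewrite ler_pdivlMr // mulrC ler_pdivrMr // -natrX -natrM ler_nat mulnC //.
  have h2 : L%:R^-1 <= D%:R ^+ k.+1 / P%:R :> R.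
    rewrite LE invfM mulrC ler_wpM2r ?invr_ge0 //.
    by apply: le_trans B1; rewrite invf_le1.
  have h3 : q%:R / L%:R ^+ k <= D%:R ^+ k.+1 / P%:R :> R.
    rewrite ler_pdivrMr ?exprn_gt0 // LE exprMn.
    apply: (@le_trans _ _ ((P ^ k.-1 * D ^ k.+1)%:R)); first by rewrite ler_nat.
    have -> : P%:R ^+ k = P%:R * P%:R ^+ k.-1 :> R by rewrite -exprS prednK.
    rewrite natrM !natrX.
    have -> : D%:R ^+ k.+1 / P%:R * (P%:R * P%:R ^+ k.-1 * D%:R ^+ k) =
      (P%:R ^+ k.-1 * D%:R ^+ k.+1) * D%:R ^+ k :> R by field; rewrite gt_eqF.
    by rewrite ler_peMr ?mulr_ge0 ?exprn_ge0 // exprn_ege1.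
  by rewrite /Th; lra.
have Th0 : 0 <= Th by rewrite !addr_ge0 ?divr_ge0 ?invr_ge0 ?exprn_ge0.
have Ths : Th `^ sigma <= 3 * D%:R ^+ k.+1 * P%:R `^ (- sigma).
  apply: le_trans (le_powR2 (ltW sigma_gt0) Th0 ThB) _.
  rewrite powRM ?mulr_ge0 ?exprn_ge0 ?invr_ge0 //.
  rewrite -powR_inv1 // -powRrM mulN1r ler_wpM2r ?powR_ge0 //.
  rewrite -[X in _ <= X]powRr1 ?mulr_ge0 ?exprn_ge0 //; apply: ler_powR.
    by rewrite (@le_trans _ _ 3) ?ler1n // ler_peMr // exprn_ege1.
  by move: sigma_le => *; lra.
have Ld : L%:R `^ (1 + delta) <= P%:R * D%:R ^+ 3.
  rewrite powRD; last by rewrite (gt_eqF LR) implybT.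
  rewrite powRr1 ?(ltW LR) // LE -mulrA ler_wpM2l // exprS ler_wpM2l //.
  rewrite powRM // expr2; apply: ler_pM; rewrite ?powR_ge0 //.
  apply: le_trans PD; apply: le_powR2; rewrite ?ler_nat //; exact: ltW.
have TB : T <= 3 * Cw * (P%:R * P%:R `^ (- sigma)) * D%:R ^+ (k + 4).
  have -> : 3 * Cw * (P%:R * P%:R `^ (- sigma)) * D%:R ^+ (k + 4) =
     Cw * ((P%:R * D%:R ^+ 3) * (3 * D%:R ^+ k.+1 * P%:R `^ (- sigma))).
    by rewrite -addSnnS exprD; ring.
  by rewrite /T -mulrA ler_wpM2l // ler_pM ?powR_ge0.
have k1 : 1 + k%:R * 2 ^+ k.-1 * D%:R ^+ k <= k%:R * 2 ^+ k * D%:R ^+ k :> R.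
  have -> : 2 ^+ k = 2 * 2 ^+ k.-1 :> R by rewrite -exprS prednK.
  have h1 : 1 <= k%:R * 2 ^+ k.-1 * D%:R ^+ k :> R.
    by rewrite !mulr_ege1 ?exprn_ege1 ?ler1n.
  by lra.
have -> : 3 * Cw * k%:R * 2 ^+ k * (P%:R * P%:R `^ (- sigma)) * D%:R ^+ (2 * k + 4)
  = (3 * Cw * (P%:R * P%:R `^ (- sigma)) * D%:R ^+ (k + 4)) *
    (k%:R * 2 ^+ k * D%:R ^+ k) :> R.
  by rewrite mul2n -addnn -addnA exprD; ring.
by rewrite ler_pM // addr_ge0 // !mulr_ge0 ?exprn_ge0.
Qed.

End MinorArcs.

(** * Major arcs *)

Section MajorArcs.
Variable R : realType.
Local Notation C := (R[i]%C).
Variables (k h : nat) (sigma delta : R) (Cw : R).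
Hypothesis k_gt2 : (2 < k)%N.
Hypothesis k_odd : odd k.
Hypothesis sigma_gt0 : 0 < sigma.
Hypothesis sigma_le : sigma <= 1 / 2.
Hypothesis delta_gt0 : 0 < delta.
Hypothesis Cw_ge1 : 1 <= Cw.
Hypothesis wb : weyl_bound k sigma delta Cw.

Let k_gt1 : (1 < k)%N. Proof. exact: ltnW. Qed.
Let k_gt0 : (0 < k)%N. Proof. exact: ltnW. Qed.

(* When [P <= D ^ h], the sums have length [n <= D ^ h.+2], and each Taylor term
   gains a factor [1 / D]: order [2 * h + 5] makes [n ^ 2 * D ^- (2 * h + 4) <= 1]. *)
Definition taylor_order : nat := (2 * h + 5)%N.
Definition deriv_const : nat := (k * taylor_order + k).+1.
(** The 9 comes from the bound on |tau| in [damped_sum_major], and 2^k covers the replacement of the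
    length L by n <= 2 L. *)
Definition major_threshold : nat := (9 * 2 ^ k * deriv_const)%N.
Definition tail_const : R := (h.+2)`!%:R.
Definition rotation_const : R :=
  2 ^+ taylor_order.+1 * (2 * taylor_order%:R + 1 + tail_const).
(** The 7 is 1 + 3 + 3: the term at 0, the incomplete sums of [gauss_term], and their mean. The 3 is
    2 from the Taylor remainders plus 1 from the term m = 0. The rotation error is doubled because
    |phi| < 2, and [tail_const] bounds the terms beyond L. *)
Definition major_const : R :=
  taylor_order%:R * 2 ^+ taylor_order.+2 * (7 * Cw) * 2
    + (3 + 2 * rotation_const + tail_const).

Lemma expRN_pow_le (D m : nat) (x : R) : D%:R <= x ->
  D%:R ^+ m.+1 * expR (- x) <= (m.+1)`!%:R.
Proof.
move=> Dx; have f0 : 0 < (m.+1)`!%:R :> R by rewrite ltr0n fact_gt0.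
apply: (@le_trans _ _ (D%:R ^+ m.+1 * expR (- D%:R))).
  by rewrite ler_wpM2l ?exprn_ge0 // ler_expR lerN2.
rewrite expRN ler_pdivrMr ?expR_gt0 // mulrC -ler_pdivrMr //.
have := @expR_ge1Dxn R D%:R m (ler0n _ _).
by apply: le_trans; rewrite lerDr.
Qed.

Lemma gauss_partial_le (a : int) (q x : nat) : (0 < q)%N -> coprimez a q%:Z ->
  (x <= q)%N ->
  normc (\sum_(i < x) gauss_term R k q a i)
    <= 1 + 3 * Cw * q%:R `^ (1 - sigma + delta).
Proof.
move=> q0 aq xq; case: x xq => [|x] xq.
  rewrite big_ord0 normc0 addr_ge0 // !mulr_ge0 ?powR_ge0 //.
  exact: le_trans Cw_ge1.
rewrite big_ord_recl; apply: le_trans (ler_normcD _ _) _.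
rewrite normc_gauss_term lerD2l.
by apply: (gauss_incomplete_le k_gt2 sigma_gt0 sigma_le) => //; exact: ltnW.
Qed.

Lemma gauss_mean_le (a : int) (q : nat) : (0 < q)%N -> coprimez a q%:Z ->
  q%:R * `|gauss_mean R k q a| <= 3 * Cw * q%:R `^ (1 - sigma + delta).
Proof.
move=> q0 aq; have qR : 0 < q%:R :> R by rewrite ltr0n.
rewrite -[X in X * _ <= _](gtr0_norm qR) -normrM -normc_real -gauss_mean_real //.
rewrite -sum_gauss_term_shift //.
by apply: (gauss_incomplete_le k_gt2 sigma_gt0 sigma_le).
Qed.

(** The real part of [tau] yields the weight and its imaginary part the factor e((alpha - a/q) m^k).
    The subtracted 1 is the term m = 0; what remains are the terms with L < m < n. *)
Lemma damped_sum_phase (a : int) (q P L n : nat) (alpha : R) (tau : C) :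
  (0 < P)%N -> (L < n)%N ->
  tau = Complex (P%:R ^- k) (- (2 * pi * (alpha - a%:~R / q%:R))) ->
  normc (\sum_(m < n) gauss_term R k q a m * cexp (pow_phase k tau).[m%:R%:C%C]
    - damped_sum k P L alpha - 1) <= n%:R * damped_weight R k P L.
Proof.
move=> P0 Ln tauE; pose beta := alpha - a%:~R / q%:R.
have EE m : gauss_term R k q a m * cexp (pow_phase k tau).[m%:R%:C%C] =
    (damped_weight R k P m)%:C%C * e_circle (alpha * m%:R ^+ k).
  have -> : alpha = a%:~R / q%:R + beta by rewrite /beta addrC subrK.
  rewrite mulrDl e_circleD mulrCA; congr (_ * _).
  rewrite /damped_weight -cexp_real e_circle_cexp -cexpD; congr cexp.
  rewrite /pow_phase !hornerE -rmorphXn /= tauE -/beta.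
  by apply/eqP; rewrite eq_complex /=; apply/andP; split; apply/eqP; ring.
rewrite (eq_bigr (fun m : 'I_n => (damped_weight R k P m)%:C%C *
  e_circle (alpha * m%:R ^+ k))) => [|m _]; last exact: EE.
rewrite -(subnKC Ln) big_split_ord /= big_ord_recl /= expr0n (gtn_eqF k_gt0) /=.
rewrite mulr0 e_circle0 /damped_weight expr0n (gtn_eqF k_gt0) mul0r oppr0 expR0.
rewrite mulr1 -/(damped_weight R k P).
rewrite [X in normc X](_ : _ = \sum_(i < n - L.+1) (damped_weight R k P (L.+1 + i))%:C%C
   * e_circle (alpha * (L.+1 + i)%:R ^+ k)); last first.
  by rewrite /damped_sum /damped_weight /=; ring.
apply: le_trans (ler_normc_sum _ _ _) _.
apply: (@le_trans _ _ (\sum_(i < n - L.+1) damped_weight R k P L)).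
  apply: ler_sum => i _; rewrite normcM normc_e_circle mulr1 normc_real.
  rewrite ger0_norm ?damped_weight_ge0 // damped_weight_anti //.
  by rewrite addSnnS leq_addr.
rewrite sumr_const card_ord -[X in X <= _]mulr_natl.
by rewrite ler_wpM2r ?damped_weight_ge0 // ler_nat leq_addl.
Qed.

Lemma damped_sum_major (alpha : R) (a : int) (q P D : nat) :
  (0 < q)%N -> coprimez a q%:Z ->
  `|alpha - a%:~R / q%:R| <= (q%:R * (P ^ k.-1 * D ^ k.+1)%:R)^-1 ->
  (major_threshold <= D)%N -> (q * D ^ k.+1 <= P)%N ->
  P%:R `^ delta <= D%:R -> (P <= D ^ h)%N ->
  exists g r phi : R,
    [/\ `|g| <= 3 * Cw * (q%:R `^ (- sigma) * D%:R), `|g| <= 1,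
        0 <= r <= 2 * (P%:R * D%:R),
        - (pi / 2) < phi < pi / 2 &
        normc (damped_sum k P (P * D) alpha
          - g%:C%C * (cexp (Complex 0 (- (k%:R^-1 * phi))) * r%:C%C))
        <= major_const * (q%:R * q%:R `^ (- sigma) * D%:R)].
Proof.
move=> q0 aq aqd DD0 qP PD PDh.
have dc0 : (0 < deriv_const)%N by [].
have D9 : (9 * deriv_const <= D)%N.
  apply: leq_trans DD0; rewrite /major_threshold mulnAC leq_pmulr // expn_gt0 //.
have D0 : (2 < D)%N.
  exact: leq_trans (isT : (2 < 9 * 1)%N) (leq_trans (leq_mul (leqnn 9) dc0) D9).
have Dp : (0 < D)%N by apply: leq_trans D0.
have P0 : (0 < P)%N.
  by apply: leq_trans qP; rewrite muln_gt0 q0 expn_gt0 Dp.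
have qR : 0 < q%:R :> R by rewrite ltr0n.
have PR : 0 < P%:R :> R by rewrite ltr0n.
have DR : 0 < D%:R :> R by rewrite ltr0n.
have dcR : 0 < deriv_const%:R :> R by rewrite ltr0n.
have D1 : 1 <= D%:R :> R by rewrite ler1n.
have Cw0 : 0 <= Cw by apply: le_trans Cw_ge1.
set L := (P * D)%N; set J := taylor_order.
have J2 : (1 < J)%N by rewrite /J /taylor_order; clear; lia.
(* The length is rounded up to a multiple of [q] for the block expansion, with L < n <= 2 L. *)
pose Y := (L %/ q).+1; pose n := (q * Y)%N.
have Ln : (L < n)%N by rewrite /n /Y mulnC ltn_ceil.
have qL : (q <= L)%N.
  apply: (@leq_trans P); last by rewrite leq_pmulr.
  by apply: leq_trans qP; rewrite leq_pmulr // expn_gt0 Dp.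
have nL : (n <= 2 * L)%N.
  by rewrite /n /Y mulnS mul2n -addnn leq_add // mulnC leq_trunc_div.
have n0 : (0 < n)%N by exact: leq_trans Ln.
have nR : 0 < n%:R :> R by rewrite ltr0n.
have nD : (n <= D ^ h.+2)%N.
  apply: leq_trans nL _; rewrite /L mulnA mulnC !expnS leq_mul // leq_mul //.
  exact: ltnW.
have nDR : n%:R <= D%:R ^+ h.+2 :> R by rewrite -natrX ler_nat.
(* [kappa] is chosen so that each derivative along a progression of step [q]
   gains exactly [1 / D]. *)
pose kappa : R := (q%:R * deriv_const%:R * D%:R)^-1.
have kappa0 : 0 <= kappa by rewrite invr_ge0 !mulr_ge0.
have nk : n%:R^-1 <= kappa.
  rewrite /kappa lef_pV2 ?posrE ?mulr_gt0 // -!natrM ler_nat.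
  apply: leq_trans (ltnW Ln); rewrite /L leq_pmul2r //.
  apply: leq_trans qP; rewrite leq_pmul2l //.
  apply: (@leq_trans D); first by apply: leq_trans D9; rewrite leq_pmull.
  by rewrite -[X in (X <= _)%N]expn1 leq_pexp2l.
set beta := alpha - a%:~R / q%:R.
pose tau : C := Complex (P%:R ^- k) (- (2 * pi * beta)).
have Pk0 : 0 < P%:R ^- k :> R by rewrite invr_gt0 exprn_gt0.
have taun : normc tau <= P%:R ^- k + 2 * pi * `|beta|.
  have -> : tau = (P%:R ^- k)%:C%C + Complex 0 (- (2 * pi * beta)).
    by apply/eqP; rewrite eq_complex /= addr0 add0r !eqxx.
  apply: le_trans (ler_normcD _ _) _; rewrite normc_real (gtr0_norm Pk0) lerD2l.
  rewrite /= expr0n add0r sqrtr_sqr normrN normrM ger0_norm //.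
  by rewrite mulr_ge0 // pi_ge0.
have tauk : normc tau * n%:R ^+ k.-1 <= kappa.
  (* 9 = 1 + 8: P^(-k) is at most 1/(q P^(k-1) D^(k+1)) because q D^(k+1) <= P, and 2 pi <= 8. *)
  have h1 : normc tau <= 9 / (q%:R * (P%:R ^+ k.-1 * D%:R ^+ k.+1)).
    apply: le_trans taun _.
    have i1 : P%:R ^- k <= (q%:R * (P%:R ^+ k.-1 * D%:R ^+ k.+1))^-1 :> R.
      rewrite lef_pV2 ?posrE ?mulr_gt0 ?exprn_gt0 // -!natrX -!natrM ler_nat.
      have -> : (P ^ k = P ^ k.-1 * P)%N by rewrite -expnSr prednK.
      rewrite mulnCA.
      by rewrite leq_mul2l qP orbT.
    rewrite natrM !natrX in aqd.
    have pi4 : pi <= 4 :> R by have := @pihalf_lt2 R; lra.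
    have i2 : 2 * pi * `|beta| <= 8 / (q%:R * (P%:R ^+ k.-1 * D%:R ^+ k.+1)).
      apply: ler_pM => //; first by rewrite mulr_ge0 // pi_ge0.
      by lra.
    by move: i1 i2; set Z := (_ * (_ * _))^-1 => i1 i2; lra.
  have h2 : n%:R ^+ k.-1 <= 2 ^+ k.-1 * (P%:R ^+ k.-1 * D%:R ^+ k.-1) :> R.
    by rewrite -!exprMn lerXn2r ?nnegrE ?mulr_ge0 // -!natrM ler_nat.
  apply: le_trans (ler_pM (normc_ge0 _) _ h1 h2) _; first by rewrite exprn_ge0.
  have -> : 9 / (q%:R * (P%:R ^+ k.-1 * D%:R ^+ k.+1)) *
      (2 ^+ k.-1 * (P%:R ^+ k.-1 * D%:R ^+ k.-1)) =
      (9 * 2 ^+ k.-1 / D%:R) / (q%:R * D%:R) :> R.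
    have -> : D%:R ^+ k.+1 = D%:R ^+ k.-1 * D%:R * D%:R :> R.
      by rewrite -!exprSr prednK.
    by field; rewrite ?mulf_neq0 ?expf_neq0 ?gt_eqF.
  rewrite /kappa [q%:R * _ * _]mulrAC [X in _ <= X]invfM mulrC.
  rewrite ler_wpM2l ?invr_ge0 ?mulr_ge0 //.
  rewrite ler_pdivrMr // [X in _ <= X]mulrC ler_pdivlMr //.
  rewrite -natrX -!natrM ler_nat; apply: leq_trans DD0.
  by rewrite /major_threshold leq_pmul2r // leq_pmul2l // leq_pexp2l // leq_pred.
have laE : q%:R * (deriv_const%:R * kappa) = D%:R^-1.
  by rewrite /kappa; field; rewrite ?gt_eqF.
have DV1 : D%:R^-1 <= 1 :> R by rewrite invf_le1.
pose w := damped_weight R k P L.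
have DkD : D%:R <= D%:R ^+ k :> R.
  by rewrite -[X in X <= _]expr1 ler_weXn2l.
have nw (x : R) : D%:R ^+ k <= x -> n%:R * expR (- x) <= tail_const.
  move=> Dx; apply: le_trans (expRN_pow_le h.+1 (le_trans DkD Dx)).
  by rewrite ler_wpM2r ?expR_ge0.
have LPD : L%:R ^+ k / P%:R ^+ k = D%:R ^+ k :> R.
  by rewrite /L natrM exprMn mulrAC divff ?mul1r // gt_eqF ?exprn_gt0.
pose g := gauss_mean R k q a.
pose Q := q%:R `^ (1 - sigma + delta) : R.
pose V := q%:R * q%:R `^ (- sigma) * D%:R : R.
have QV : Q <= V.
  rewrite /Q /V powRD; last by rewrite (gt_eqF qR) implybT.
  rewrite powRD; last by rewrite (gt_eqF qR) implybT.
  rewrite powRr1 ?(ltW qR) // ler_wpM2l ?mulr_ge0 ?powR_ge0 //.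
  apply: le_trans PD; apply: le_powR2; rewrite ?ler_nat ?(ltW delta_gt0) //.
  by apply: leq_trans qP; rewrite leq_pmulr // expn_gt0 Dp.
have Q1 : 1 <= Q.
  rewrite -(powRr0 q%:R) ler_powR ?ler1n //.
  by move: sigma_le delta_gt0 => *; lra.
have V1 : 1 <= V by apply: le_trans QV.
have [rho [phi [rho0 phi2 tauE]]] := @polar_form R _ (- (2 * pi * beta)) Pk0.
rewrite -/tau in tauE.
have tauP : P%:R ^- k = rho * cos phi by have := congr1 (@complex.Re R) tauE.
(* Along the rotation the real part rho cos theta never drops below rho cos phi = P^(-k), so the
   damping at n is uniform. The modulus rho is unchanged, so the same [kappa] serves for every
   theta. *)
have rotation theta : `|theta| <= `|phi| ->
    normc (\sum_(m < n) phase_fun (pow_phase k (polar rho theta))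
      (phase_deriv (pow_phase k (polar rho theta)) 'X) m%:R) <= rotation_const.
  move=> th; have cth : P%:R ^- k <= rho * cos theta.
    rewrite tauP ler_wpM2l //; apply: ler_cos_abs => //.
    rewrite ler_norml; have := @pihalf_lt2 R; have := @pi_ge2 R.
    by move/andP: phi2 => [? ?] ? ?; lra.
  have rhoN : normc (polar rho theta) = normc tau by rewrite tauE !normc_polar.
  have laE' : (k * J + k).+1%:R * kappa = D%:R^-1 / q%:R.
    by rewrite -laE -/J [q%:R * _]mulrC mulfK // gt_eqF.
  have qV1 : q%:R^-1 <= 1 :> R by rewrite invf_le1 // ler1n.
  have qV0 : 0 <= q%:R^-1 :> R by rewrite invr_ge0.
  have DV0 : 0 <= D%:R^-1 :> R by rewrite invr_ge0.
  apply: (@sum_derivative_Xphase_le R k (polar rho theta) k_gt0 n J kappa) => //.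
  - by apply: le_trans cth; rewrite ltW.
  - by rewrite rhoN.
  - by rewrite laE' mulr_ile1.
  - rewrite laE'; apply: (@le_trans _ _ ((D%:R ^+ h.+2) ^+ 2 * D%:R ^- J.-1)).
      apply: ler_pM; rewrite ?exprn_ge0 ?mulr_ge0 //.
        by rewrite lerXn2r ?nnegrE ?exprn_ge0.
      rewrite -exprVn lerXn2r ?nnegrE ?mulr_ge0 //.
      by rewrite ler_piMr.
    rewrite -exprM ler_pdivrMr ?exprn_gt0 // mul1r ler_weXn2l //.
    by rewrite /J /taylor_order; clear; lia.
  - apply: nw; apply: (@le_trans _ _ (P%:R ^- k * n%:R ^+ k)); last first.
      by rewrite ler_wpM2r ?exprn_ge0.
    rewrite -LPD mulrC ler_wpM2l ?invr_ge0 ?exprn_ge0 //.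
    by rewrite lerXn2r ?nnegrE // ler_nat ltnW.
have [r rn rotE] := @rotate_phase_sum R k n rho k_gt0 phi rotation_const rotation.
exists g, r, phi; split=> //.
- have := gauss_mean_le q0 aq; rewrite -/g -/Q => gQ.
  rewrite -(ler_pM2l qR); apply: le_trans gQ _.
  rewrite mulrCA ler_wpM2l ?mulr_ge0 // mulrA.
  exact: QV.
- exact: gauss_mean_le1.
- have /andP[r0 rn'] := rn rho0; rewrite r0 /=; apply: le_trans rn' _.
  by rewrite -!natrM ler_nat.
have := @damped_sum_phase a q P L n alpha tau P0 Ln (erefl _).
 set SE := \sum_(m < n) _ => extra.
pose c m : C := gauss_term R k q a m - g%:C%C.
pose SB := \sum_(m < n) cexp (pow_phase k tau).[m%:R%:C%C].
have SEE : SE = \sum_(m < n) c m * cexp (pow_phase k tau).[m%:R%:C%C] + g%:C%C * SB.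
  rewrite /SB mulr_sumr -big_split; apply: eq_bigr => m _.
  by rewrite /c /= -mulrDl subrK.
have cs x : \sum_(i < x) c i = \sum_(i < x) gauss_term R k q a i - (x%:R * g)%:C%C.
  by rewrite sumrB sumr_const card_ord [x%:R * g]mulr_natl rmorphMn.
have periodic : normc (\sum_(m < n) c m * cexp (pow_phase k tau).[m%:R%:C%C])
    <= J%:R * 2 ^+ J.+2 * (7 * Cw * V) * 2 + 2.
  apply: (@sum_periodic_phase_le R k tau k_gt0 c q Y J (7 * Cw * V) kappa) => //.
  - by move=> m; rewrite /c gauss_term_periodic.
  - by rewrite cs gauss_mean_real // subrr.
  - move=> x xq; rewrite cs; apply: le_trans (ler_normcB _ _) _.
    have h1 := gauss_partial_le q0 aq xq.
    have h2 : normc (x%:R * g)%:C%C <= 3 * Cw * Q.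
      rewrite normc_real; apply: le_trans (gauss_mean_le q0 aq).
      by rewrite normrM normr_nat ler_wpM2r // ler_nat.
    have h3 : Cw * Q <= Cw * V by rewrite ler_wpM2l.
    have h4 : 1 <= Cw * V by rewrite mulr_ege1.
    by rewrite -/Q in h1; lra.
  - move=> m; apply: le_trans (ler_normcB _ _) _.
    rewrite normc_gauss_term normc_real.
    by have := @gauss_mean_le1 R k q a q0; rewrite -/g; lra.
  - exact: ltW.
  - by rewrite laE.
  - rewrite laE exprVn ler_pdivrMr ?exprn_gt0 // mul1r; apply: le_trans nDR _.
    by rewrite ler_weXn2l //; rewrite /J /taylor_order; clear; lia.
rewrite -tauE -/SB in rotE.
set main := cexp _ * r%:C%C in rotE *.
have -> : damped_sum k P L alpha - g%:C%C * main =
   (\sum_(m < n) c m * cexp (pow_phase k tau).[m%:R%:C%C])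
   + (g%:C%C * (SB - main) - (SE - damped_sum k P L alpha - 1) - 1).
  by rewrite SEE; ring.
have e1 := ler_normcD (\sum_(m < n) c m * cexp (pow_phase k tau).[m%:R%:C%C])
   (g%:C%C * (SB - main) - (SE - damped_sum k P L alpha - 1) - 1).
have e2 := ler_normcB (g%:C%C * (SB - main) - (SE - damped_sum k P L alpha - 1)) 1.
have e3 := ler_normcB (g%:C%C * (SB - main)) (SE - damped_sum k P L alpha - 1).
have e4 : normc (g%:C%C * (SB - main)) <= 2 * rotation_const.
  rewrite normcM normc_real -[X in _ <= X]mul1r.
  apply: ler_pM; rewrite ?normc_ge0 //; first exact: gauss_mean_le1.
  apply: le_trans rotE _; rewrite [X in _ <= X]mulrC ler_wpM2l //.
    by rewrite /rotation_const /tail_const mulr_ge0 ?exprn_ge0 ?addr_ge0 ?mulr_ge0.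
  rewrite ler_norml; have := @pihalf_lt2 R; move/andP: phi2 => [? ?] ?; lra.
have e5 : n%:R * damped_weight R k P L <= tail_const.
  by rewrite /damped_weight LPD; apply: nw.
rewrite normc1 in e2.
have RC0 : 0 <= 2 * rotation_const by apply: le_trans e4; exact: normc_ge0.
have TC0 : 0 <= tail_const by rewrite ler0n.
have e6 : 3 + 2 * rotation_const + tail_const <=
    (3 + 2 * rotation_const + tail_const) * V.
  by rewrite ler_peMr // !addr_ge0.
have -> : major_const * V = J%:R * 2 ^+ J.+2 * (7 * Cw * V) * 2
   + (3 + 2 * rotation_const + tail_const) * V.
  by rewrite /major_const -/J; ring.
move: periodic extra e1 e2 e3 e4 e5 e6; rewrite /major_const.
set X1 := J%:R * _ * _ * _.
by move=> *; lra.
Qed.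

End MajorArcs.

(** * One-sided bound and Fourier counting *)

Section OneSidedBound.
Variable R : realType.
Local Notation C := (R[i]%C).
Variables (k h s : nat) (sigma delta : R) (Cw : R).
Hypothesis k_gt2 : (2 < k)%N.
Hypothesis k_odd : odd k.
Hypothesis sigma_gt0 : 0 < sigma.
Hypothesis s_gt0 : (0 < s)%N.
Hypothesis s_even : ~~ odd s.
Hypothesis s_le_k : (s <= k)%N.
Hypothesis ssigma_le : s%:R * sigma <= 1 / 2.
Hypothesis delta_gt0 : 0 < delta.
Hypothesis Cw_ge1 : 1 <= Cw.
Hypothesis wb : weyl_bound k sigma delta Cw.

Let k_gt0 : (0 < k)%N. Proof. exact: ltnW (ltnW _). Qed.

Let sigma_le : sigma <= 1 / 2.
Proof.
by apply: le_trans ssigma_le; rewrite ler_peMl ?(ltW sigma_gt0) // ler1n.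
Qed.

Definition one_sided_const : R :=
  (3 * Cw * k%:R * 2 ^+ k) ^+ s + s%:R * (6 * Cw + major_const h Cw) ^+ s.

Definition one_sided_error (P D : nat) : R :=
  one_sided_const * (P%:R * P%:R `^ (- sigma)) ^+ s * D%:R ^+ ((2 * k + 4) * s).

Let Cw_ge0 : 0 <= Cw. Proof. exact: le_trans Cw_ge1. Qed.

Lemma major_const_ge0 : 0 <= major_const h Cw.
Proof.
have t0 : 0 <= tail_const R h by rewrite ler0n.
rewrite /major_const /rotation_const; apply: addr_ge0.
  apply: mulr_ge0 => //; apply: mulr_ge0; last exact: mulr_ge0.
  by apply: mulr_ge0 => //; exact: exprn_ge0.
apply: addr_ge0 => //; apply: addr_ge0 => //; apply: mulr_ge0 => //.
apply: mulr_ge0; first exact: exprn_ge0.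
by apply: addr_ge0 => //; apply: addr_ge0 => //; exact: mulr_ge0.
Qed.

Lemma one_sided_const_ge0 : 0 <= one_sided_const.
Proof.
have := major_const_ge0 => m0; apply: addr_ge0.
  by apply: exprn_ge0; rewrite !mulr_ge0 ?exprn_ge0.
by rewrite mulr_ge0 // exprn_ge0 // addr_ge0 // mulr_ge0.
Qed.

Lemma one_sided_error_ge0 (P D : nat) : 0 <= one_sided_error P D.
Proof.
by rewrite !mulr_ge0 ?one_sided_const_ge0 ?exprn_ge0 ?mulr_ge0 ?powR_ge0.
Qed.

(** Both sides are powers with exponent 1 - s sigma, which is nonnegative by [ssigma_le]. This is
    how the major arc error is brought to the size of the minor arc bound. *)
Lemma mul_powRN_expn_le (q P : nat) : (0 < q <= P)%N ->
  q%:R * (q%:R `^ (- sigma)) ^+ s <= P%:R * (P%:R `^ (- sigma)) ^+ s :> R.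
Proof.
move=> /andP[q0 qP]; have P0 := leq_trans q0 qP.
have E (m : nat) : (0 < m)%N ->
    m%:R * (m%:R `^ (- sigma)) ^+ s = m%:R `^ (1 - s%:R * sigma) :> R.
  move=> m0; rewrite -powR_mulrn ?powR_ge0 // -powRrM.
  rewrite -{1}(@powRr1 _ m%:R) // -powRD; first by congr (_ `^ _); ring.
  by apply/implyP => _; rewrite pnatr_eq0 -lt0n.
rewrite !E //; apply: le_powR2; rewrite ?ler_nat //.
by move: ssigma_le => *; lra.
Qed.

Lemma Re_damped_sum_expn_ge (P D : nat) (alpha : R) :
  (major_threshold k h <= D)%N -> (D <= P)%N ->
  P%:R `^ delta <= D%:R -> (P <= D ^ h)%N ->
  - one_sided_error P D <= complex.Re (damped_sum k P (P * D) alpha ^+ s).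
Proof.
move=> DD0 DP PD PDh.
have D0 : (0 < D)%N by apply: leq_trans DD0; rewrite !muln_gt0 expn_gt0.
have P0 : (0 < P)%N by exact: leq_trans DP.
have DR : 1 <= D%:R :> R by rewrite ler1n.
have m0 := major_const_ge0.
set f := damped_sum _ _ _ _.
(* This level is both the largest [q] that [damped_sum_minor] allows and the precision that
   [damped_sum_major] requires, so the split on q D^(k+1) <= P leaves no gap. *)
have Q0 : (0 < P ^ k.-1 * D ^ k.+1)%N by rewrite muln_gt0 !expn_gt0 P0 D0.
have [q [a [/andP[q0 qQ] aq aqd]]] := dirichlet_approx alpha Q0.
have qR : 0 < q%:R :> R by rewrite ltr0n.
have PR : 0 < P%:R :> R by rewrite ltr0n.
have pw0 (x : R) : 0 <= x `^ (- sigma) by exact: powR_ge0.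
have [qP|Pq] := leqP (q * D ^ k.+1) P; last first.
  apply: le_trans (Re_ge_opp_normc _); rewrite lerN2 normcX.
  have aqd2 : `|alpha - a%:~R / q%:R| <= q%:R ^- 2.
    apply: le_trans aqd _; rewrite lef_pV2 ?posrE ?mulr_gt0 ?exprn_gt0 ?ltr0n //.
    by rewrite expr2 ler_wpM2l // ler_nat.
  have DP' : (0 < D <= P)%N by rewrite D0.
  have := damped_sum_minor k_gt2 sigma_gt0 sigma_le delta_gt0 Cw_ge1 wb
    q0 aq aqd2 DP' PD (ltnW Pq) qQ.
  rewrite -/f => fB.
  apply: (@le_trans _ _ ((3 * Cw * k%:R * 2 ^+ k * (P%:R * P%:R `^ (- sigma))
      * D%:R ^+ (2 * k + 4)) ^+ s)).
    rewrite lerXn2r ?nnegrE ?normc_ge0 //.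
    exact: le_trans (normc_ge0 _) fB.
  rewrite /one_sided_error exprM !exprMn -exprMn -[X in _ <= X * _ * _]/(one_sided_const).
  rewrite !ler_wpM2r ?exprn_ge0 ?mulr_ge0 //.
  rewrite /one_sided_const -!exprMn lerDl.
  by rewrite mulr_ge0 // exprn_ge0 // addr_ge0 // mulr_ge0.
have [g [r [phi [gq g1 /andP[r0 rPD] phi2 err]]]] :=
  damped_sum_major k_gt2 k_odd sigma_gt0 sigma_le delta_gt0 Cw_ge1 wb q0 aq aqd
  DD0 qP PD PDh.
rewrite -/f in err; set z := g%:C%C * _ in err.
have qleP : (q <= P)%N by apply: leq_trans qP; rewrite leq_pmulr // expn_gt0 D0.
have qPR : q%:R <= P%:R :> R by rewrite ler_nat.
pose m := 6 * Cw + major_const h Cw.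
have m00 : 0 <= m by rewrite addr_ge0 // mulr_ge0.
pose U : R := P%:R * q%:R `^ (- sigma) * D%:R ^+ 2.
have U0 : 0 <= U by rewrite !mulr_ge0 ?exprn_ge0.
have zB : normc z <= 6 * Cw * U.
  rewrite normcM normc_real normcM normc_cexp /= expR0 mul1r -[X in _ * X]/(normc r%:C%C).
  rewrite normc_real (ger0_norm r0).
  apply: le_trans (ler_pM (normr_ge0 _) r0 gq rPD) _.
  by rewrite le_eqVlt; apply/orP; left; apply/eqP; rewrite /U; ring.
have eB : normc (f - z) <= major_const h Cw * U.
  apply: le_trans err _; rewrite ler_wpM2l // /U expr2.
  have -> : q%:R * q%:R `^ (- sigma) * D%:R = (q%:R `^ (- sigma) * D%:R) * q%:R :> R.
    by ring.
  have -> : P%:R * q%:R `^ (- sigma) * (D%:R * D%:R) =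
    (q%:R `^ (- sigma) * D%:R) * (P%:R * D%:R) :> R by ring.
  rewrite ler_wpM2l ?mulr_ge0 //; apply: le_trans qPR _.
  by rewrite ler_peMr.
have fB : normc f <= m * U.
  have -> : f = z + (f - z) by rewrite addrC subrK.
  by apply: le_trans (ler_normcD _ _) _; rewrite /m mulrDl lerD.
have zB' : normc z <= m * U by apply: le_trans zB _; rewrite /m ler_wpM2r // lerDl.
have z0 := Re_rotated_expn_ge0 g r k_gt0 s_le_k s_even phi2.
rewrite -/z in z0.
have fz : normc (f ^+ s - z ^+ s) <= one_sided_error P D.
  rewrite -(prednK s_gt0); apply: le_trans (normc_expB_le _ fB zB') _.
  rewrite (prednK s_gt0).
  have h1 : normc (f - z) <= m * (q%:R * q%:R `^ (- sigma) * D%:R).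
    apply: le_trans err _; rewrite ler_wpM2r ?mulr_ge0 //.
    by rewrite /m lerDr mulr_ge0.
  apply: (@le_trans _ _ (s%:R * (m * (q%:R * q%:R `^ (- sigma) * D%:R))
      * (m * U) ^+ s.-1)).
    rewrite ler_wpM2r ?exprn_ge0 ?mulr_ge0 //.
    by rewrite ler_wpM2l.
  (* All [s] factors q^(-sigma), one from f - z and the others from [U], are gathered beside the
     single factor q, ready for [mul_powRN_expn_le]. *)
  have -> : s%:R * (m * (q%:R * q%:R `^ (- sigma) * D%:R)) * (m * U) ^+ s.-1 =
     (s%:R * m ^+ s) * ((q%:R * (q%:R `^ (- sigma)) ^+ s) * P%:R ^+ s.-1
      * (D%:R * (D%:R ^+ 2) ^+ s.-1)).
    rewrite -[in m ^+ s](prednK s_gt0) -[in (_ `^ _) ^+ s](prednK s_gt0).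
    by rewrite /U !exprMn !exprS; ring.
  apply: (@le_trans _ _ ((s%:R * m ^+ s) * ((P%:R * (P%:R `^ (- sigma)) ^+ s) * P%:R ^+ s.-1
      * D%:R ^+ ((2 * k + 4) * s)))).
    rewrite ler_wpM2l ?mulr_ge0 ?exprn_ge0 //.
    apply: ler_pM; rewrite ?mulr_ge0 ?exprn_ge0 //.
      by rewrite ler_wpM2r ?exprn_ge0 // mul_powRN_expn_le // q0.
    rewrite -exprM -exprS ler_weXn2l //.
    rewrite -[X in (_ <= _ * X)%N](prednK s_gt0).
    by clear; nia.
  have PsE : P%:R ^+ s = P%:R * P%:R ^+ s.-1 :> R by rewrite -exprS prednK.
  rewrite /one_sided_error exprMn.
  have -> : one_sided_const * (P%:R ^+ s * (P%:R `^ (- sigma)) ^+ s)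
      * D%:R ^+ ((2 * k + 4) * s) = one_sided_const *
     (P%:R * (P%:R `^ (- sigma)) ^+ s * P%:R ^+ s.-1 * D%:R ^+ ((2 * k + 4) * s)).
    by rewrite PsE; ring.
  rewrite ler_wpM2r ?mulr_ge0 ?exprn_ge0 //.
  by rewrite /one_sided_const lerDr exprn_ge0 // !mulr_ge0 ?exprn_ge0.
have -> : f ^+ s = z ^+ s + (f ^+ s - z ^+ s) by rewrite addrC subrK.
rewrite ReD; have := Re_ge_opp_normc (f ^+ s - z ^+ s).
by move=> *; lra.
Qed.

End OneSidedBound.

Section FourierCounting.
Variable R : realType.
Local Notation C := (R[i]%C).

Lemma sum_e_circle_eq0 (Q : nat) (t : int) : (`|t| < Q)%N -> t != 0 ->
  \sum_(j < Q) e_circle (j%:R / Q%:R * t%:~R : R) = 0.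
Proof.
move=> tQ t0; have Q0 : (0 < Q)%N by apply: leq_ltn_trans tQ.
have QR : 0 < Q%:R :> R by rewrite ltr0n.
pose z : C := e_circle (t%:~R / Q%:R).
have zQ : z ^+ Q = 1.
  by rewrite -e_circleMn -[_ *+ Q]mulr_natr divfK ?gt_eqF // e_circle_int.
have z1 : z - 1 != 0.
  have nat_case (n : nat) : (0 < n < Q)%N -> e_circle (n%:R / Q%:R : R) <> 1.
    move=> /andP[n0 nQ]; apply: e_circle_eq1.
    by rewrite divr_gt0 ?ltr0n //= ltr_pdivrMr // mul1r ltr_nat.
  apply/eqP => /eqP; rewrite subr_eq0 /z => /eqP.
  case: t tQ t0 {z zQ} => n /= nQ n0 e.
    by apply: (nat_case n) => //; rewrite nQ lt0n andbT.
  apply: (nat_case n.+1); first by rewrite nQ.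
  have -> : n.+1%:R / Q%:R = - ((Negz n)%:~R / Q%:R) :> R.
    by rewrite NegzE mulrNz mulNr opprK.
  by rewrite e_circleN e conjc1.
apply: (mulfI z1); rewrite mulr0 -[RHS](subrr (1 : C)) -{2}zQ subrX1.
congr (_ * _); apply: eq_bigr => j _; rewrite -e_circleMn.
by congr e_circle; rewrite -[RHS]mulr_natl; ring.
Qed.

Variables (k s N L : nat) (w : nat -> R) (A : {fset int}).
Hypothesis s_gt0 : (0 < s)%N.
Hypothesis A_itv : forall x : int, x \in A -> 1 <= x <= N%:Z.
Hypothesis A_diff : difference_set [set` A] `&` power_sums k s = set0.

Let T (alpha : R) : C :=
  (\sum_(m < L) (w m)%:C%C * e_circle (alpha * m.+1%:R ^+ k)) ^+ s.

Let F (alpha : R) : C := \sum_(x <- enum_fset A) e_circle (alpha * x%:~R).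

(* Larger than every |x - y + n|, so that averaging over the points [j / Q]
   detects exactly the zero frequency. *)
Let Q : nat := (N + s * L ^ k).+1.

Let pt (j : nat) : R := j%:R / Q%:R.

Let W (phi : {ffun 'I_s -> 'I_L}) : R := \prod_i w (phi i).

Let tot (phi : {ffun 'I_s -> 'I_L}) : nat := (\sum_i (phi i).+1 ^ k)%N.

Lemma expn_weighted_sumE (alpha : R) :
  T alpha = \sum_phi (W phi)%:C%C * e_circle (alpha * (tot phi)%:R).
Proof.
rewrite /T -[s in _ ^+ s]card_ord -prodr_const bigA_distr_bigA.
apply: eq_bigr => phi _; rewrite big_split /= rmorph_prod; congr (_ * _).
rewrite -e_circle_sum; congr e_circle.
by rewrite -mulr_sumr natr_sum; congr (_ * _); apply: eq_bigr => i _; rewrite natrX.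
Qed.

Lemma norm_sqr_sumE (alpha : R) : (normc (F alpha) ^+ 2)%:C%C =
  \sum_(x <- enum_fset A) \sum_(y <- enum_fset A) e_circle (alpha * (x - y)%:~R).
Proof.
rewrite -mulc_conj /F rmorph_sum mulr_suml; apply: eq_bigr => x _.
rewrite mulr_sumr; apply: eq_bigr => y _.
rewrite -[X in _ * X]/((e_circle (alpha * y%:~R))^*)%C.
by rewrite -e_circleN -e_circleD intrB; congr e_circle; ring.
Qed.

Lemma sum_norm_sqr : \sum_(j < Q) normc (F (pt j)) ^+ 2 = Q%:R * (#|` A|)%:R.
Proof.
apply: (@complexI R); rewrite rmorph_sum /=.
under eq_bigr => j _ do rewrite norm_sqr_sumE.
rewrite exchange_big /= big_seq.
rewrite (eq_bigr (fun=> Q%:R%:C%C)) => [|x xA].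
  by rewrite -big_seq big_const_seq count_predT iter_addr_0 -rmorphMn -mulr_natr.
rewrite exchange_big /= (bigD1_seq x) //= ?fset_uniq //.
rewrite (eq_bigr (fun=> 1)) => [|j _]; last by rewrite subrr mulr0 e_circle0.
rewrite sumr_const card_ord big_seq_cond big1 ?addr0 ?rmorph_nat // => y.
move=> /andP[yA yx]; apply: sum_e_circle_eq0; last by rewrite subr_eq0 eq_sym.
have := A_itv xA; have := A_itv yA; rewrite /Q; move: (s * L ^ k)%N => Z.
by clear; lia.
Qed.

Lemma sum_norm_sqr_weighted : \sum_(j < Q) normc (F (pt j)) ^+ 2 * complex.Re (T (pt j)) = 0.
Proof.
under eq_bigr => j _ do rewrite -Re_realM norm_sqr_sumE expn_weighted_sumE.
rewrite -Re_sum (_ : \sum_(j < Q) _ = 0) //.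
under eq_bigr => j _ do rewrite mulr_suml.
rewrite exchange_big /= big_seq big1 // => x xA.
under eq_bigr => j _ do rewrite mulr_suml.
rewrite exchange_big /= big_seq big1 // => y yA.
under eq_bigr => j _ do rewrite mulr_sumr.
rewrite exchange_big /= big1 // => phi _.
rewrite (eq_bigr (fun j : 'I_Q => (W phi)%:C%C * e_circle (pt j * (x - y + (tot phi)%:Z)%:~R)));
  last by move=> j _; rewrite mulrCA -e_circleD -mulrDr -[_%:R]/((tot phi)%:Z%:~R) -intrD.
rewrite -mulr_sumr sum_e_circle_eq0 ?mulr0 //.
  have totL : (tot phi <= s * L ^ k)%N.
    rewrite -[s in (s * _)%N]card_ord -sum_nat_const; apply: leq_sum => i _.
    by have [->//|k0] := posnP k; rewrite leq_exp2r.
  have := A_itv xA; have := A_itv yA; move: totL; rewrite /Q.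
  by move: (s * L ^ k)%N (tot phi) => Z n; clear; lia.
apply/eqP => xy; have : (difference_set [set` A] `&` power_sums k s) (y - x).
  split; first by exists y => //; exists x.
  exists (fun i => (phi i).+1) => //.
  have -> : y - x = (tot phi)%:Z.
    by move: (tot phi) xy => z; clear; lia.
  rewrite /tot -[LHS]natz natr_sum; apply: eq_bigr => i _.
  by rewrite natrX natz.
by rewrite A_diff.
Qed.

(** The sum of |F|^2 (Re T + E) over the points j/Q equals Q |A| E, and its terms are nonnegative.
    Keeping only j = 0 gives |A|^2 Re T(0) <= Q |A| E, and one factor |A| cancels. *)
Lemma card_le_of_one_sided (E : R) : 0 <= E ->
  (forall alpha, - E <= complex.Re (T alpha)) ->
  (#|` A|)%:R * complex.Re (T 0) <= Q%:R * E.
Proof.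
move=> E0 TE; have [->|A0] := eqVneq #|` A| 0%N; first by rewrite mul0r mulr_ge0.
have AR : 0 < (#|` A|)%:R :> R by rewrite ltr0n lt0n.
rewrite -(ler_pM2l AR) mulrCA [X in _ <= X]mulrCA mulrA.
have eq1 : \sum_(j < Q) normc (F (pt j)) ^+ 2 * (complex.Re (T (pt j)) + E) =
    Q%:R * (#|` A|)%:R * E.
  under eq_bigr => j _ do rewrite mulrDr.
  by rewrite big_split /= sum_norm_sqr_weighted add0r -mulr_suml sum_norm_sqr.
rewrite mulrA -eq1 big_ord_recl /= {1 2}/pt mul0r.
have -> : F 0 = (#|` A|)%:R.
  rewrite /F (eq_bigr (fun=> 1)) => [|x _]; last by rewrite mul0r e_circle0.
  by rewrite big_const_seq count_predT iter_addr_0.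
rewrite normc_nat -expr2 mulrDr -addrA lerDl addr_ge0 ?mulr_ge0 ?exprn_ge0 //.
apply: sumr_ge0 => j _; rewrite mulr_ge0 ?exprn_ge0 ?normc_ge0 //.
by rewrite -[E]opprK subr_ge0.
Qed.

End FourierCounting.

(** * Choice of the parameters and final estimate *)

Section Assembly.
Variable R : realType.

Lemma powR_ge1 (a x : R) : 1 <= a -> 0 <= x -> 1 <= a `^ x.
Proof. by move=> a1 x0; rewrite -[X in X <= _](powRr0 a) ler_powR. Qed.

(* The trivial bound covers the range where the base of the power exceeds 1. *)
Lemma weyl_bound_of_admissible (k : nat) (sigma sigma' delta : R) :
  weyl_admissible k sigma -> 0 < sigma' <= sigma -> 0 < delta ->
  exists2 Cw : R, 1 <= Cw & weyl_bound k sigma' delta Cw.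
Proof.
move=> [sigma_gt0 adm] /andP[s0 ss] delta0; have [C0 hC] := adm _ delta0.
exists (Num.max 1 C0) => [|n alpha a q n0 q0 aq aqd]; first by rewrite le_max lexx.
have nR : 0 < n%:R :> R by rewrite ltr0n.
have qR : 0 < q%:R :> R by rewrite ltr0n.
set b := q%:R^-1 + _ + _; have b0 : 0 < b.
  by rewrite !addr_gt0 ?divr_gt0 ?invr_gt0 ?exprn_gt0.
have C1 : 1 <= Num.max 1 C0 by rewrite le_max lexx.
have Cp : 0 <= Num.max 1 C0 by exact: le_trans C1.
have [b1|b1] := leP b 1.
  have := hC n%:R alpha a q nR q0 aq aqd.
  rewrite weyl_sum_natr normcE_norm lecR -/b => h.
  apply: le_trans h _; rewrite -mulrA; apply: (@le_trans _ _ (Num.max 1 C0 *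
    (n%:R `^ (1 + delta) * b `^ sigma))).
    by rewrite ler_wpM2r ?mulr_ge0 ?powR_ge0 // le_max lexx orbT.
  by rewrite ler_wpM2l // ler_wpM2l ?powR_ge0 // ger_powR // b0.
apply: le_trans (monomial_sum_trivial _ _ _) _.
apply: (@le_trans _ _ (n%:R `^ (1 + delta))).
  rewrite -[X in X <= _]powRr1 // ler_powR ?ler1n //.
  by rewrite lerDl ltW.
have bs : 1 <= b `^ sigma'.
  by rewrite powR_ge1 // ltW.
apply: (@le_trans _ _ (n%:R `^ (1 + delta) * b `^ sigma')).
  by rewrite ler_peMr ?powR_ge0.
by rewrite ler_peMl // mulr_ge0 ?powR_ge0.
Qed.

(** At alpha = 0 there is no cancellation, and each of the first P weights is at least 1/e. *)
Lemma Re_damped_sum0_ge (k P D s : nat) : (0 < P)%N -> (0 < D)%N ->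
  (P%:R * expR (-1)) ^+ s <= complex.Re (damped_sum k P (P * D) (0 : R) ^+ s).
Proof.
move=> P0 D0.
have -> : damped_sum k P (P * D) (0 : R) =
    (\sum_(m < P * D) damped_weight R k P m.+1)%:C%C.
  rewrite rmorph_sum; apply: eq_bigr => m _.
  by rewrite mul0r e_circle0 mulr1.
rewrite -rmorphXn /=; apply: lerXn2r; rewrite ?nnegrE ?mulr_ge0 ?expR_ge0 //.
  by apply: sumr_ge0 => m _; exact: damped_weight_ge0.
have -> : (P * D = P + P * D.-1)%N by rewrite -mulnS prednK.
rewrite big_split_ord /= -[X in X <= _]addr0; apply: lerD; last first.
  by apply: sumr_ge0 => m _; exact: damped_weight_ge0.
rewrite mulr_natl -[X in _ *+ X]card_ord -sumr_const; apply: ler_sum => m _.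
rewrite ler_expR lerN2 ler_pdivrMr ?exprn_gt0 ?ltr0n // mul1r.
by rewrite lerXn2r ?nnegrE // ler_nat.
Qed.

Lemma truncnS_itv (x : R) : 1 <= x ->
  x <= (Num.truncn x).+1%:R <= 2 * x.
Proof.
move=> x1; have x0 : 0 <= x by exact: le_trans x1.
have /andP[h1 h2] := truncn_itv x0; rewrite (ltW h2) /=.
by rewrite -natr1; move: h1 x1; clear; lra.
Qed.

End Assembly.

Theorem theorem1p1 (R : realType) (k s : nat) (sigma : R)
    (k_gt1 : (1 < k)%N) (k_odd : odd k)
    (s_gt0 : (0 < s)%N) (s_even : ~~ odd s) (s_le_k : (s <= k)%N)
    (sigma_adm : weyl_admissible k sigma) (eps : R) (eps_gt0 : 0 < eps) :
  exists2 C : R, 0 < C &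
    forall (N : nat) (A : {fset int}),
      (0 < N)%N ->
      (forall x : int, x \in A -> 1 <= x <= N%:Z) ->
      difference_set [set` A] `&` power_sums k s = set0 ->
      (#|` A|)%:R <=
        C * N%:R `^ (1 - k%:R^-1 * Num.min (s%:R * sigma) (1 / 2) + eps).
Proof.
have k_gt2 : (2 < k)%N by case: k k_gt1 k_odd {s_le_k sigma_adm} => [|[|[|?]]].
have k_gt0 : (0 < k)%N by exact: ltnW.
have kR : 0 < k%:R :> R by rewrite ltr0n.
have sR : 0 < s%:R :> R by rewrite ltr0n.
have s1 : 1 <= s%:R :> R by rewrite ler1n.
have k1 : 1 <= k%:R :> R by rewrite ler1n.
have sigma_gt0 : 0 < sigma by case: sigma_adm.
pose sg := Num.min (s%:R * sigma) (1 / 2) / s%:R.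
have sgE : Num.min (s%:R * sigma) (1 / 2) = s%:R * sg by rewrite /sg [RHS]mulrC divfK ?gt_eqF.
have sg_gt0 : 0 < sg by rewrite /sg divr_gt0 // lt_min mulr_gt0 //=.
have ssg : s%:R * sg <= 1 / 2 by rewrite -sgE ge_min lexx orbT.
have sg_le : sg <= sigma by rewrite /sg ler_pdivrMr // mulrC ge_min lexx.
(* [K] counts the powers of [D] that are lost, each costing [N ^ (delta / k)]. *)
rewrite sgE; pose K := ((2 * k + 4) * s + k)%N.
(* Above K/eps, so that K delta <= eps, and at least 2, as [DP] requires. *)
pose h := (Num.truncn (K%:R / eps)).+2; pose delta : R := h%:R^-1.
have hR : 0 < h%:R :> R by rewrite ltr0n.
have delta_gt0 : 0 < delta by rewrite invr_gt0.
have Kd : K%:R * delta <= eps.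
  rewrite /delta ler_pdivrMr // mulrC -ler_pdivrMr //.
  apply: ltW; apply: lt_trans (truncnS_gt _) _; by rewrite ltr_nat.
have sg_itv : 0 < sg <= sigma by rewrite sg_gt0.
have [Cw Cw_ge1 wb] := weyl_bound_of_admissible sigma_adm sg_itv delta_gt0.
pose D0 := major_threshold k h.
(* s + 2 bounds the number of sample points in units of (P D)^k. With t = N^(1/k) and v = P^delta,
   2^k comes from P <= 2 t, and 4^K from D <= 2 v together with v^K <= (2 t)^(delta K), where delta
   <= 1. *)
pose C1 := (s.+2%:R * one_sided_const k h s Cw / expR (-1) ^+ s) *
  (2 ^+ k * 4 ^+ K).
have osc0 := one_sided_const_ge0 k h s Cw_ge1.
have C10 : 0 <= C1.
  by rewrite /C1 mulr_ge0 ?divr_ge0 ?mulr_ge0 ?exprn_ge0 ?expR_ge0.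
pose C2 : R := (D0 ^ (h * k))%:R.
have C20 : 0 <= C2 by rewrite ler0n.
exists (1 + C1 + C2) => [|N A N0 A_itv A_diff].
  by rewrite ltr_wpDr // ltr_pwDl.
set x := 1 - _ + eps.
have NR : 1 <= N%:R :> R by rewrite ler1n.
have NR0 : 0 < N%:R :> R by rewrite ltr0n.
have ksg : k%:R^-1 * (s%:R * sg) <= 1.
  rewrite mulrC ler_pdivrMr // mul1r; apply: le_trans ssg _.
  by move: k1; clear; lra.
have x0 : 0 <= x by rewrite addr_ge0 ?subr_ge0 // ltW.
have Nx : 1 <= N%:R `^ x by exact: powR_ge1.
pose t : R := N%:R `^ k%:R^-1.
have t1 : 1 <= t by rewrite powR_ge1 // invr_ge0 ltW.
have t0 : 0 <= t by exact: le_trans t1.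
have tE (y : R) : N%:R `^ y = t `^ (k%:R * y).
  by rewrite /t -powRrM mulrA mulVf ?mul1r // gt_eqF.
pose P := (Num.truncn t).+1; have /andP[tP Pt] := truncnS_itv t1.
rewrite -/P in tP Pt.
have P1 : 1 <= P%:R :> R by rewrite ler1n.
have P_gt1 : (1 < P)%N by rewrite /P ltnS truncn_gt0.
pose v : R := P%:R `^ delta.
have v1 : 1 <= v by rewrite powR_ge1 // ltW.
have v0 : 0 <= v by exact: le_trans v1.
have vh : v ^+ h = P%:R by rewrite -powR_mulrn // -powRrM mulVf ?gt_eqF // powRr1.
pose D := (Num.truncn v).+1; have /andP[vD Dv] := truncnS_itv v1.
rewrite -/D in vD Dv.
have PDh : (P <= D ^ h)%N.
  by rewrite -(ler_nat R) natrX -vh lerXn2r ?nnegrE.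
(* Otherwise P <= v, hence P^h <= v^h = P, which is impossible for P >= 2 and h >= 2. *)
have DP : (D <= P)%N.
  rewrite /D truncn_lt_nat // ltNge; apply/negP => Pv.
  have : P%:R ^+ h <= P%:R :> R by rewrite -{2}vh lerXn2r ?nnegrE.
  rewrite -natrX ler_nat leqNgt -{1}[P]expn1 ltn_exp2l //.
have NPk : (N <= P ^ k)%N.
  rewrite -(ler_nat R) natrX -[X in X <= _](@powRr1 _ N%:R) ?(ltW NR0) // tE mulr1.
  by rewrite powR_mulrn // lerXn2r ?nnegrE.
have cardN : (#|` A| <= N)%N.
  have sub : {subset enum_fset A <= [seq (i.+1)%:Z | i <- iota 0 N]}.
    move=> y yA; have := A_itv y yA; case: y {yA} => // -[//|n] /andP[_ nN].
    by apply/mapP; exists n => //; rewrite mem_iota add0n.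
  by rewrite (leq_trans (uniq_leq_size (fset_uniq A) sub)) // size_map size_iota.
(* A bounded [D] bounds N through N <= P^k <= D^(h k), and then the trivial estimate |A| <= N is
   absorbed by [C2]. *)
have [DD0|DD0] := leqP D0 D; last first.
  apply: (@le_trans _ _ (C2 * N%:R `^ x)); last first.
    by rewrite ler_wpM2r ?powR_ge0 // lerDr addr_ge0.
  apply: (@le_trans _ _ C2); last by rewrite ler_peMr // ler0n.
  rewrite ler_nat (leq_trans cardN) // (leq_trans NPk) // expnM.
  rewrite leq_exp2r // (leq_trans PDh) // leq_exp2r //; exact: ltnW.
have P0 : (0 < P)%N by [].
have Dp : (0 < D)%N by [].
have E0 := one_sided_error_ge0 k h s sg Cw_ge1 P D.
have TE alpha := Re_damped_sum_expn_ge k_gt2 k_odd sg_gt0 s_gt0 s_even s_le_k ssg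
  delta_gt0 Cw_ge1 wb alpha DD0 DP vD PDh.
have := @card_le_of_one_sided R k s N (P * D) (fun m => damped_weight R k P m.+1) A
  A_itv A_diff _ E0 TE.
rewrite -/(damped_sum k P (P * D) (0 : R)) => main.
have low := Re_damped_sum0_ge R k s P0 Dp.
have e0 : 0 < expR (-1) ^+ s :> R by rewrite exprn_gt0 ?expR_gt0.
have Ps0 : 0 < P%:R ^+ s :> R by rewrite exprn_gt0 ?ltr0n.
have Qle : (N + s * (P * D) ^ k).+1%:R <= s.+2%:R * (P%:R ^+ k * D%:R ^+ k) :> R.
  rewrite -exprMn -natrM -natrX -natrM ler_nat.
  have h1 : (N <= (P * D) ^ k)%N.
    by apply: leq_trans NPk _; rewrite expnMn leq_pmulr // expn_gt0.
  have h2 : (0 < (P * D) ^ k)%N by rewrite expn_gt0 muln_gt0.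
  by move: h1 h2; move: ((P * D) ^ k)%N; clear; nia.
(* Dividing by the value at alpha = 0, at least (P/e)^s, cancels the P^s of the error. There remain
   P^k D^k from the number of sample points, the saving P^(-s sg), and the powers of D in the
   error. *)
have step : (#|` A|)%:R <= (s.+2%:R * one_sided_const k h s Cw / expR (-1) ^+ s) *
   ((P%:R ^+ k * (P%:R `^ (- sg)) ^+ s) * D%:R ^+ K).
  rewrite -(ler_pM2r Ps0) -(ler_pM2r e0).
  apply: (@le_trans _ _ ((#|` A|)%:R * complex.Re (damped_sum k P (P * D) (0 : R) ^+ s))).
    by rewrite -mulrA -exprMn ler_wpM2l.
  apply: le_trans main _; apply: le_trans (ler_wpM2r E0 Qle) _.
  rewrite /one_sided_error exprMn /K exprD le_eqVlt; apply/orP; left; apply/eqP.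
  by field; rewrite gt_eqF.
apply: le_trans step _.
apply: (@le_trans _ _ (C1 * N%:R `^ x)); last first.
  by rewrite ler_wpM2r ?powR_ge0 // addrAC lerDr addr_ge0 // ler0n.
rewrite /C1 -[X in _ <= X]mulrA ler_wpM2l ?divr_ge0 ?mulr_ge0 ?exprn_ge0 ?expR_ge0 //.
have PR0 : 0 < P%:R :> R by rewrite ltr0n.
have b1 : P%:R ^+ k * (P%:R `^ (- sg)) ^+ s <= 2 ^+ k * t `^ (k%:R - s%:R * sg).
  have ks0 : 0 <= k%:R - s%:R * sg.
    by move: ssg k1; clear; lra.
  have e1 : P%:R ^+ k = P%:R `^ k%:R :> R by rewrite powR_mulrn // ltW.
  have e2 : (P%:R `^ (- sg)) ^+ s = P%:R `^ (- sg * s%:R).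
    by rewrite powRrM powR_mulrn // powR_ge0.
  rewrite e1 e2 -powRD; last by rewrite (gt_eqF PR0) implybT.
  have -> : k%:R + - sg * s%:R = k%:R - s%:R * sg by ring.
  apply: le_trans (le_powR2 ks0 (ltW PR0) Pt) _.
  rewrite powRM // ler_wpM2r ?powR_ge0 //.
  rewrite -[X in _ <= X]powR_mulrn // ler_powR ?ler1n //.
  by rewrite gerBl mulr_ge0 // ltW.
have b2 : D%:R ^+ K <= 4 ^+ K * t `^ (k%:R * eps).
  apply: (@le_trans _ _ ((2 * v) ^+ K)); first by rewrite lerXn2r ?nnegrE ?mulr_ge0.
  have -> : 4 ^+ K = 2 ^+ K * 2 ^+ K :> R by rewrite -exprMn; congr (_ ^+ _); ring.
  rewrite exprMn -mulrA ler_wpM2l ?exprn_ge0 //.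
  have -> : v ^+ K = P%:R `^ (delta * K%:R).
    by rewrite powRrM powR_mulrn.
  have Kd0 : 0 <= delta * K%:R by rewrite mulr_ge0 // ltW.
  apply: le_trans (le_powR2 Kd0 (ltW PR0) Pt) _.
  rewrite powRM //; apply: ler_pM; rewrite ?powR_ge0 //.
    rewrite -[X in _ <= X]powR_mulrn // ler_powR ?ler1n // ler_piMl // invf_le1 // ler1n //.
  apply: ler_powR => //; rewrite mulrC; apply: le_trans Kd _.
  by rewrite ler_peMl // ltW.
apply: le_trans (ler_pM _ _ b1 b2) _.
- by rewrite mulr_ge0 ?exprn_ge0 ?powR_ge0.
- by rewrite exprn_ge0.
have -> : N%:R `^ x = t `^ (k%:R - s%:R * sg) * t `^ (k%:R * eps).
  rewrite tE -powRD; last by rewrite (gt_eqF (lt_le_trans ltr01 t1)) implybT.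
  by congr (_ `^ _); rewrite /x; field; rewrite gt_eqF.
by rewrite le_eqVlt; apply/orP; left; apply/eqP; ring.
Qed.
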